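(* Let $\kappa \in (0,1)$ and $\lambda = \sqrt{1-\kappa^2}$. For $\mu \in (0,1)$ let $p_{\mu} = \wp(\,\cdot\,; g_2, g_3)$ be the Weierstrass $\wp$ function with invariants $$g_2 = \tfrac{4}{27}(9 - 8\mu^2), \qquad g_3 = \tfrac{8}{729}(27 - 36\mu^2 + 8\mu^4),$$ and let $(2\omega_{\mu}, 2\omega_{\mu}')$ be the fundamental pair of periods of $p_{\mu}$ for which $\omega_{\mu}$ and $-i\,\omega_{\mu}'$ are strictly positive. Let $q_{\kappa} = \wp(\,\cdot\,; \omega_{\kappa}, \tfrac{1}{3}\omega_{\kappa}')$ be the Weierstrass $\wp$ function with fundamental half-periods $\omega_{\kappa}$ and $\tfrac13 \omega_{\kappa}'$. Then for all $z \in \mathbb{C}$, $$q_{\kappa}(z) = -3\, p_{\lambda}(\sqrt{3}\, i\, z).$$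
   Context: $\wp(\,\cdot\,; g_2, g_3)$ denotes the Weierstrass elliptic function with invariants $g_2, g_3$, and $\wp(\,\cdot\,; \omega, \omega')$ denotes the Weierstrass elliptic function whose period lattice is generated by $2\omega$ and $2\omega'$. *)

(* Defs.v *)
From HB Require Import structures.
From mathcomp Require Import all_boot all_order all_algebra finmap complex.
From mathcomp Require Import all_classical all_reals all_analysis.
From mathcomp Require Import summability.

Set Implicit Arguments.
Unset Strict Implicit.
Unset Printing Implicit Defensive.

Import Order.TTheory GRing.Theory Num.Theory.
Import numFieldNormedType.Exports.

Local Open Scope classical_set_scope.
Local Open Scope complex_scope.
Local Open Scope ring_scope.

Section Weierstrass.
Variable R : realType.
Local Notation C := R[i].

Definition lattice (a b : C) : set C :=
  [set w | exists m n : int, w = a *~ m + b *~ n].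

(* b / a not real: a and b are linearly independent over the reals (and, as
   x / 0 = 0, both nonzero) *)
Definition is_lattice (L : set C) : Prop :=
  exists a b : C, b / a \isn't Num.real /\ L = lattice a b.

(* Limit along the net of finite sets of nonzero lattice points, so no order of
   summation is chosen; the terms used below are absolutely summable *)
Definition lattice_sum (L : set C) (f : C -> C) : C :=
  summability.sum (fun w : C => (if w \in L `\ 0 then f w else 0) : C^o).

(* Values lie in the Riemann sphere; None is the point at infinity *)
Definition weierstrass_p (L : set C) (z : C) : one_point_compactification C :=
  if z \in L then None
  else Some (z ^- 2 + lattice_sum L (fun w => (z - w) ^- 2 - w ^- 2)).

Definition lattice_g2 (L : set C) : C := 60 * lattice_sum L (fun w => w ^- 4).
Definition lattice_g3 (L : set C) : C := 140 * lattice_sum L (fun w => w ^- 6).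

(* A lattice is determined by its invariants, so the choice made by xget does
   not matter; when no lattice has the given invariants the default setT makes
   the function constantly infinite *)
Definition wp_invariants (g2 g3 : C) : C -> one_point_compactification C :=
  weierstrass_p (xget setT
    [set L | [/\ is_lattice L, lattice_g2 L = g2 & lattice_g3 L = g3]]).

Definition wp_half_periods (w w' : C) : C -> one_point_compactification C :=
  weierstrass_p (lattice (2 * w) (2 * w')).

Definition is_period (T : Type) (f : C -> T) (w : C) : Prop :=
  forall z, f (z + w) = f z.

Definition fundamental_pair_of_periods (T : Type) (f : C -> T) (a b : C) : Prop :=
  b / a \isn't Num.real /\ [set w | is_period f w] = lattice a b.

Definition p_ (mu : R) : C -> one_point_compactification C :=
  wp_invariants (4 / 27 * (9 - 8 * mu ^+ 2))%:C
    (8 / 729 * (27 - 36 * mu ^+ 2 + 8 * mu ^+ 4))%:C.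

End Weierstrass.

(* Main.v *)
Require Import Defs.
From mathcomp Require Import all_boot all_order all_algebra finmap complex.
From mathcomp Require Import all_classical all_reals all_analysis.
From mathcomp Require Import ring lra zify.
From mathcomp Require summability.

(* Both sides are Weierstrass functions of lattices, so everything reduces to an
   identity of invariants: with a = 2 omega and b = 2 omega', the lattice
   sqrt(3) i (Z a + Z b/3) must have the invariants attached to lambda.

   Write E_k(z) for the sum of (z + w)^-k over a lattice and G_k = E_k(0).
   Expanding E_3 * P into a double sum and summing it in both orders gives
   E_5 = P E_3 off the lattice (the terms of index r and -r telescope).
   Consequences:
   - near 0 this determines all G_k from G_4 and G_6, and the moments G_k
     determine the lattice: lattices with equal invariants coincide;
   - E_4 - P^2 and then E_3^2 - P^3 + 15 G_4 P have derivative 0, whence the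
     usual differential equations along segments issued from 0.
   For t = b/3 the index 3 overlattice has G_k' = G_k + 2 E_k(t) for even k, and
   7 G_8' = 3 G_4'^2 turns into the 3-division equation for x = P(t).  The lattice
   being rectangular, x is real and E_3(t)^2 <= 0, which singles out the root
   x = -1/3; then G_4' and G_6' are explicit. *)

Set Implicit Arguments.
Unset Strict Implicit.
Unset Printing Implicit Defensive.

Import Order.TTheory GRing.Theory Num.Theory numFieldNormedType.Exports.
Local Open Scope complex_scope.
Local Open Scope ring_scope.

(** * Unordered summation of complex families *)

Section ComplexNorm.
Variable R : rcfType.
Implicit Types z w : R[i].

(** Every identity comes from rearranging series; no residues and no Liouville theorem enter. The
    double sum is that of [(z+w)^-3 P(z+w)] over w, which equals P E_3 by periodicity, each P(z+w)
    being expanded as a series in r; the column r = 0 is E_5. The obstacle is absolute summability: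
    the columns are telescoped through first and second inverse powers, whose lattice sums do not
    converge absolutely. The term [p^-3 ((p+r)^-2 - r^-2)] has degree -5, and the triangle with
    sides p, r, p + r allows a bound by products of two weights of exponent 5/2 on its sides. Since
    5/2 > 2, such a weight is summable over a planar lattice. Constants of integration are read off
    from the Laurent expansions at 0, so the differential equations are obtained only at points t
    whose segment ]0, t] avoids the lattice; b/3 is such a point. With x = -1/3 and s = kappa^2, one
    finds g2' = 40/3 - 9 g2, which is 9 times the value of g2 at 1 - s, and g3' is -27 times that of
    g3. These factors are the fourth and sixth powers of sqrt(3) i, whence the scaling in the
    theorem. *)

Definition cnorm z : R := complex.Re `|z|.

Lemma cnormE z : (cnorm z)%:C = `|z|.
Proof. by rewrite /cnorm (normc_def z). Qed.

Lemma cnorm_ge0 z : 0 <= cnorm z.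
Proof. by rewrite -lecR cnormE normr_ge0. Qed.

Lemma cnormM z w : cnorm (z * w) = cnorm z * cnorm w.
Proof. by apply: complexI; rewrite rmorphM /= !cnormE normrM. Qed.

Lemma cnormD z w : cnorm (z + w) <= cnorm z + cnorm w.
Proof. by rewrite -lecR rmorphD /= !cnormE ler_normD. Qed.

Lemma cnormN z : cnorm (- z) = cnorm z.
Proof. by apply: complexI; rewrite !cnormE normrN. Qed.

Lemma cnormB z w : cnorm (z - w) <= cnorm z + cnorm w.
Proof. by rewrite -(cnormN w) cnormD. Qed.

Lemma cnorm0 : cnorm 0 = 0.
Proof. by apply: complexI; rewrite cnormE normr0. Qed.

Lemma cnorm1 : cnorm 1 = 1.
Proof. by apply: complexI; rewrite cnormE normr1. Qed.

Lemma cnormV z : cnorm z^-1 = (cnorm z)^-1.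
Proof. by apply: complexI; rewrite fmorphV /= !cnormE normfV. Qed.

Lemma cnormX z n : cnorm (z ^+ n) = cnorm z ^+ n.
Proof. by apply: complexI; rewrite rmorphXn /= !cnormE normrX. Qed.

Lemma cnorm_eq0 z : (cnorm z == 0) = (z == 0).
Proof. by rewrite -[RHS]normr_eq0 -cnormE eq_complex /= eqxx andbT. Qed.

Lemma cnorm_gt0 z : (0 < cnorm z) = (z != 0).
Proof. by rewrite lt_def cnorm_ge0 andbT cnorm_eq0. Qed.

Lemma cnormR (x : R) : cnorm x%:C = `|x|.
Proof. by rewrite /cnorm normc_def /= expr0n addr0 sqrtr_sqr. Qed.

Lemma Re_le_cnorm z : `|complex.Re z| <= cnorm z.
Proof. by rewrite -lecR cnormE normc_ge_Re. Qed.

Lemma Im_le_cnorm z : `|complex.Im z| <= cnorm z.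
Proof.
have := Re_le_cnorm (z * 'i%C); rewrite ReiNIm normrN cnormM.
suff -> : cnorm 'i%C = 1 by rewrite mulr1.
by rewrite /cnorm normc_def /= expr0n expr1n add0r sqrtr1.
Qed.

Lemma cnorm_sum (I : Type) (s : seq I) (f : I -> R[i]) :
  cnorm (\sum_(i <- s) f i) <= \sum_(i <- s) cnorm (f i).
Proof.
elim/big_rec2: _ => [|i x y _ le]; first by rewrite cnorm0.
by rewrite (le_trans (cnormD _ _)) // lerD2l.
Qed.

Lemma cnorm_lt_eps z : (forall e : R, 0 < e -> cnorm z <= e) -> z = 0.
Proof.
move=> h; apply/eqP; rewrite -cnorm_eq0; apply: contraT => nz.
have p : 0 < cnorm z by rewrite lt_def nz cnorm_ge0.
have := h (cnorm z / 2); lra.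
Qed.

End ComplexNorm.

Section RealSummable.
Variable R : realType.

Definition rsummable (I : eqType) (g : I -> R) : Prop :=
  exists M, forall s : seq I, uniq s -> \sum_(i <- s) g i <= M.

Lemma rsummable_le (I : eqType) (f g : I -> R) (c : R) :
  0 <= c -> (forall i, f i <= c * g i) -> rsummable g -> rsummable f.
Proof.
move=> c0 le [M hM]; exists (c * M) => s us.
apply: (le_trans (y := \sum_(i <- s) c * g i)); first exact: ler_sum.
by rewrite -mulr_sumr ler_wpM2l ?hM.
Qed.

Lemma rsummableD (I : eqType) (f g : I -> R) :
  rsummable f -> rsummable g -> rsummable (fun i => f i + g i).
Proof.
move=> [M hM] [M' hM']; exists (M + M') => s us.
by rewrite big_split /= lerD ?hM ?hM'.
Qed.

Lemma rsummable_inj (I J : eqType) (f : J -> R) (phi : I -> J) :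
  injective phi -> rsummable f -> rsummable (f \o phi).
Proof.
move=> inj [M hM]; exists M => s us.
by rewrite -(big_map phi xpredT) hM // map_inj_uniq.
Qed.

Lemma ler_sum_subset (I : eqType) (f : I -> R) (s t : seq I) :
  (forall i, 0 <= f i) -> uniq s -> uniq t -> {subset s <= t} ->
  \sum_(i <- s) f i <= \sum_(i <- t) f i.
Proof.
move=> f0 us ut sub; rewrite [leRHS](bigID (mem s)) /= -[leLHS]addr0.
rewrite lerD ?sumr_ge0 // -[leRHS]big_filter.
rewrite (perm_big [seq x <- t | x \in s]) //.
apply: uniq_perm; rewrite ?filter_uniq // => k; rewrite mem_filter.
by case: (boolP (k \in s)) => //= /sub ->.
Qed.

Lemma rsummable_prod (I J : eqType) (f : I -> R) (g : J -> R) :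
  (forall i, 0 <= f i) -> (forall j, 0 <= g j) ->
  rsummable f -> rsummable g -> rsummable (fun k : I * J => f k.1 * g k.2).
Proof.
move=> f0 g0 [M hM] [M' hM']; exists (M * M') => s us.
set s1 := undup (map fst s); set s2 := undup (map snd s).
have u12 : uniq (allpairs pair s1 s2).
  by rewrite allpairs_uniq ?undup_uniq // => -[? ?] [? ?] _ _ [-> ->].
apply: (le_trans (y := \sum_(k <- allpairs pair s1 s2) f k.1 * g k.2)).
  apply: ler_sum_subset => // [k|[i j] ins]; first by rewrite mulr_ge0.
  by apply/allpairsP; exists (i, j); split=> //=;
    rewrite mem_undup; apply/mapP; exists (i, j).
rewrite big_allpairs_dep /=.
under eq_bigr => i _ do rewrite -mulr_sumr.
rewrite -mulr_suml ler_pM ?sumr_ge0 ?hM ?hM' ?undup_uniq //.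
Qed.

Lemma rsummable_nat (f : nat -> R) (M : R) :
  (forall n, 0 <= f n) -> (forall n, \sum_(k < n) f k <= M) ->
  forall s, uniq s -> \sum_(k <- s) f k <= M.
Proof.
move=> f0 hM s us; apply: le_trans (hM (\max_(k <- s) k).+1).
rewrite -(big_mkord xpredT) ler_sum_subset ?iota_uniq // => k ks.
by rewrite mem_index_iota ltnS /= (big_rem k) //= leq_maxl.
Qed.

Lemma rsummable_int (f : nat -> R) (M : R) :
  (forall n, 0 <= f n) -> (forall n, \sum_(k < n) f k <= M) ->
  rsummable (fun m : int => f `|m|%N).
Proof.
move=> f0 hM; exists (M + M) => s us.
rewrite (bigID (fun m : int => 0 <= m)) /= lerD // -big_filter;
  rewrite -(big_map absz xpredT) (rsummable_nat f0 hM) //;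
  rewrite map_inj_in_uniq ?filter_uniq //;
  move=> x y; rewrite !mem_filter => /andP[x0 _] /andP[y0 _]; lia.
Qed.

End RealSummable.

Section Summation.
Variable R : realType.
Local Notation C := R[i].

Definition summable (I : eqType) (f : I -> C) : Prop :=
  rsummable (fun i => cnorm (f i)).

(** The net of finite subsets, encoded by duplicate-free sequences; [hassum_lim] carries it over to
    [summability.sum]. *)
Definition hassum (I : eqType) (f : I -> C) (S : C) : Prop :=
  forall e : R, 0 < e -> exists s0 : seq I,
    forall s, uniq s -> {subset s0 <= s} -> cnorm (\sum_(i <- s) f i - S) < e.

Lemma hassum_unique (I : eqType) (f : I -> C) S T :
  hassum f S -> hassum f T -> S = T.
Proof.
move=> hS hT; apply/eqP; rewrite -subr_eq0; apply/eqP/cnorm_lt_eps => e e0.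
have [s1 h1] := hS (e / 2) ltac:(lra); have [s2 h2] := hT (e / 2) ltac:(lra).
set s := undup (s1 ++ s2).
have {}h1 := h1 s (undup_uniq _).
have {}h2 := h2 s (undup_uniq _).
have i1 : {subset s1 <= s} by move=> x; rewrite mem_undup mem_cat => ->.
have i2 : {subset s2 <= s} by move=> x; rewrite mem_undup mem_cat orbC => ->.
have -> : S - T = (\sum_(i <- s) f i - T) - (\sum_(i <- s) f i - S) by ring.
have := cnormB (\sum_(i <- s) f i - T) (\sum_(i <- s) f i - S).
have := h1 i1; have := h2 i2; lra.
Qed.

Lemma eq_hassum (I : eqType) (f g : I -> C) S :
  f =1 g -> hassum f S -> hassum g S.
Proof. by move=> /funext ->. Qed.

Lemma hassum0 (I : eqType) : hassum (fun _ : I => 0) 0.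
Proof. by move=> e e0; exists [::] => s _ _; rewrite big1 // subrr cnorm0. Qed.

Lemma hassumD (I : eqType) (f g : I -> C) S T :
  hassum f S -> hassum g T -> hassum (fun i => f i + g i) (S + T).
Proof.
move=> hS hT e e0.
have [s1 h1] := hS (e / 2) ltac:(lra); have [s2 h2] := hT (e / 2) ltac:(lra).
exists (s1 ++ s2) => s us sub; rewrite big_split /=.
have i1 : {subset s1 <= s} by move=> x xs; apply: sub; rewrite mem_cat xs.
have i2 : {subset s2 <= s} by move=> x xs; apply: sub; rewrite mem_cat xs orbT.
rewrite opprD addrACA.
have := cnormD (\sum_(i <- s) f i - S) (\sum_(i <- s) g i - T).
have := h1 s us i1; have := h2 s us i2; lra.
Qed.

Lemma hassumZ (I : eqType) (f : I -> C) S c :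
  hassum f S -> hassum (fun i => c * f i) (c * S).
Proof.
move=> hS e e0; have c0 := cnorm_ge0 c.
have [|s0 h0] := hS (e / (cnorm c + 1)); first by rewrite divr_gt0 //; lra.
exists s0 => s us sub; rewrite -mulr_sumr -mulrBr cnormM.
have := h0 s us sub; rewrite ltr_pdivlMr; last lra.
have := cnorm_ge0 (\sum_(i <- s) f i - S); nra.
Qed.

Lemma hassumN (I : eqType) (f : I -> C) S :
  hassum f S -> hassum (fun i => - f i) (- S).
Proof.
move=> /(hassumZ (-1)); rewrite mulN1r; apply: eq_hassum => i.
by rewrite mulN1r.
Qed.

Lemma hassumB (I : eqType) (f g : I -> C) S T :
  hassum f S -> hassum g T -> hassum (fun i => f i - g i) (S - T).
Proof. by move=> hS hT; apply: hassumD => //; apply: hassumN. Qed.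

Lemma hassum_sum (I : eqType) (K : Type) (r : seq K) (f : K -> I -> C) S :
  (forall k, hassum (f k) (S k)) ->
  hassum (fun i => \sum_(k <- r) f k i) (\sum_(k <- r) S k).
Proof.
move=> h; elim: r => [|k r IH].
  rewrite big_nil; apply: eq_hassum (@hassum0 I) => i; by rewrite big_nil.
rewrite big_cons; apply: eq_hassum (hassumD (h k) IH) => i.
by rewrite big_cons.
Qed.

Lemma hassum_single (I : eqType) (i0 : I) (c : C) :
  hassum (fun i => if i == i0 then c else 0) c.
Proof.
move=> e e0; exists [:: i0] => s us sub.
have i0s : i0 \in s by apply: sub; rewrite mem_head.
by rewrite -big_mkcond /= -big_filter filter_pred1_uniq // big_seq1 subrr cnorm0.
Qed.

(** [psi] is the partial inverse of [phi]. Terms outside the image vanish, so [pmap psi] turns a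
    finite sum over J into a finite sum over I with the same value. *)
Lemma hassum_pinj (I J : eqType) (phi : I -> J) (psi : J -> option I)
    (f : J -> C) S :
  (forall i, psi (phi i) = Some i) ->
  (forall j i, psi j = Some i -> phi i = j) ->
  (forall j, psi j = None -> f j = 0) ->
  hassum (f \o phi) S -> hassum f S.
Proof.
move=> h1 h2 h3 hS e e0; have [s0 h0] := hS e e0.
exists (map phi s0) => s us sub.
have -> : \sum_(j <- s) f j = \sum_(i <- pmap psi s) (f \o phi) i.
  elim: s {us sub} => [|j s IH]; first by rewrite !big_nil.
  rewrite big_cons IH /=; case E : (psi j) => [i|] /=.
    by rewrite big_cons /= (h2 _ _ E).
  by rewrite h3 ?add0r.
apply: h0; last first.
  by move=> i i0; rewrite mem_pmap -h1 map_f // sub // map_f.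
apply: (pmap_uniq (g := phi)) => // j; rewrite /oapp.
by case E : (psi j) => [i|] //; rewrite (h2 _ _ E).
Qed.

Lemma hassum_bij (I J : eqType) (phi : I -> J) (psi : J -> I) (f : J -> C) S :
  cancel phi psi -> cancel psi phi -> hassum f S -> hassum (f \o phi) S.
Proof.
move=> h1 h2 h; apply: (hassum_pinj (phi := psi) (psi := fun i => Some (phi i))) => //.
- by move=> j; rewrite h2.
- by move=> j i [<-].
- apply: eq_hassum h => j /=; by rewrite h2.
Qed.

Lemma hassum_norm_le (I : eqType) (f : I -> C) (M : R) S :
  (forall s, uniq s -> \sum_(i <- s) cnorm (f i) <= M) -> hassum f S ->
  cnorm S <= M.
Proof.
move=> hM hS; rewrite leNgt; apply/negP => lt.
have [s0 h0] := hS (cnorm S - M) ltac:(lra).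
have {}h0 := h0 (undup s0) (undup_uniq _).
have := h0 (fun x => ltac:(by rewrite mem_undup)).
have := hM (undup s0) (undup_uniq _).
have := cnorm_sum (undup s0) f.
have := cnormB (\sum_(i <- undup s0) f i) (\sum_(i <- undup s0) f i - S).
rewrite opprB addrC subrK; lra.
Qed.

Lemma rhassum_ex (I : eqType) (g : I -> R) :
  (forall i, 0 <= g i) -> rsummable g -> exists S : R, hassum (fun i => (g i)%:C) S%:C.
Proof.
move=> g0 [M hM].
pose A := [set x | exists2 s : seq I, uniq s & x = \sum_(i <- s) g i]%classic.
have hA : has_sup A.
  split; first by exists 0; exists [::]; rewrite ?big_nil.
  by exists M => _ [s us ->]; exact: hM.
exists (sup A) => e e0.
have [_ [s0 us0 ->] lt0] := sup_adherent e0 hA.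
exists s0 => s us sub.
have le1 : \sum_(i <- s0) g i <= \sum_(i <- s) g i.
  exact: ler_sum_subset.
have le2 : \sum_(i <- s) g i <= sup A.
  by apply: sup_upper_bound => //; exists s.
rewrite -rmorph_sum -rmorphB /= cnormR ler0_norm; lra.
Qed.

(** The real part is the difference of the nonnegative families |f| + Re f and |f|, both dominated
    by 2 |f|; likewise for the imaginary part. *)
Lemma summable_hassum (I : eqType) (f : I -> C) :
  summable f -> exists S, hassum f S.
Proof.
move=> hf; have n0 i := cnorm_ge0 (f i).
have [A hA] := rhassum_ex n0 hf.
have [B hB] : exists S : R, hassum (fun i => (cnorm (f i) + complex.Re (f i))%:C) S%:C.
  apply: rhassum_ex => [i|].
    by have := Re_le_cnorm (f i); rewrite ler_norml => /andP[]; lra.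
  apply: (rsummable_le (c := 2)) hf => // i.
  by have := Re_le_cnorm (f i); rewrite ler_norml => /andP[]; lra.
have [D hD] : exists S : R, hassum (fun i => (cnorm (f i) + complex.Im (f i))%:C) S%:C.
  apply: rhassum_ex => [i|].
    by have := Im_le_cnorm (f i); rewrite ler_norml => /andP[]; lra.
  apply: (rsummable_le (c := 2)) hf => // i.
  by have := Im_le_cnorm (f i); rewrite ler_norml => /andP[]; lra.
exists ((B%:C - A%:C) + 'i%C * (D%:C - A%:C)).
apply: eq_hassum (hassumD (hassumB hB hA) (hassumZ 'i%C (hassumB hD hA))) => i.
have e (x y : R) : (x + y)%:C - x%:C = y%:C by rewrite rmorphD addrAC subrr add0r.
by rewrite !e -complexE.
Qed.

(** For a finite set s of rows, a finite set t of columns can be chosen that both approximates all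
    row sums of s and makes s x t contain the exceptional set [s0] of the total sum. *)
Lemma hassum_fubini (I J : eqType) (f : I * J -> C) (g : I -> C) S :
  hassum f S -> (forall i, hassum (fun j => f (i, j)) (g i)) -> hassum g S.
Proof.
move=> hS hg e e0; have [s0 h0] := hS (e / 2) ltac:(lra).
exists (map fst s0) => s us sub.
have [t0 k0] := hassum_sum s hg (e := e / 2) ltac:(lra).
set t := undup (t0 ++ map snd s0).
have ut : uniq t := undup_uniq _.
have st : {subset t0 <= t} by move=> x; rewrite mem_undup mem_cat => ->.
have ust : uniq (allpairs pair s t).
  by rewrite allpairs_uniq // => -[? ?] [? ?] _ _ [-> ->].
have ss : {subset s0 <= allpairs pair s t}.
  move=> [i j] ij; apply/allpairsP; exists (i, j); split=> //=.
    by apply: sub; apply/mapP; exists (i, j).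
  by rewrite mem_undup mem_cat; apply/orP; right; apply/mapP; exists (i, j).
have := h0 _ ust ss; have := k0 _ ut st.
rewrite big_allpairs_dep /= exchange_big /=.
set P := \sum_(i <- s) _; set Q := \sum_(i <- s) _ => h1 h2.
have := cnormB (P - S) (P - Q).
have -> : P - S - (P - Q) = Q - S by ring.
lra.
Qed.

Lemma hassum_telescope (f : int -> C) S :
  hassum (fun n => f n - f (n - 1)) S ->
  (forall e : R, 0 < e -> exists s0 : seq int, forall n, n \notin s0 -> cnorm (f n) < e) ->
  S = 0.
Proof.
move=> hS vf; apply: cnorm_lt_eps => e e0.
have [s0 h0] := hS (e / 3) ltac:(lra).
have [s1 h1] := vf (e / 3) ltac:(lra).
(* The window of summation is [-N, N - 1], which leaves f(N - 1) - f(-N - 1); the [.+2] puts both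
   indices outside [s1]. *)
pose N := (\max_(k <- s0 ++ s1) `|k|%N).+2.
have hN k : k \in s0 ++ s1 -> (`|k|.+1 < N)%N.
  by move=> ks; rewrite !ltnS /N (big_rem k) //= leq_maxl.
pose t := [seq (k%:Z - N%:Z) | k <- iota 0 (N + N)].
have ut : uniq t by rewrite map_inj_uniq ?iota_uniq // => x y /addIr [].
have st : {subset s0 <= t}.
  move=> k ks; have := hN k; rewrite mem_cat ks => /(_ isT).
  move: k {ks} => k kN.
  apply/mapP; exists (absz ((k : int) + N%:Z)).
    by rewrite mem_iota /= add0n; lia.
  by lia.
have := h0 t ut st.
have -> : \sum_(i <- t) (f i - f (i - 1)) = f (N%:Z - 1) - f (- N%:Z - 1).
  rewrite big_map.
  have tel M : \sum_(k <- iota 0 M) (f (k%:Z - N%:Z) - f (k%:Z - N%:Z - 1)) =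
     f (M%:Z - N%:Z - 1) - f (- N%:Z - 1).
    elim: M => [|M IH]; first by rewrite big_nil sub0r subrr.
    rewrite -addn1 iotaD big_cat IH /= big_seq1 add0n addrC.
    have -> : (M + 1)%N%:Z - N%:Z - 1 = M%:Z - N%:Z by rewrite PoszD; ring.
    by ring.
  by rewrite tel PoszD addrK.
have h2 k : (N <= `|k|.+1)%N -> cnorm (f k) < e / 3.
  move=> Nk; apply: h1; apply/negP => ks.
  have := hN k; rewrite mem_cat ks orbT => /(_ isT); lia.
have := h2 (N%:Z - 1) ltac:(lia); have := h2 (- N%:Z - 1) ltac:(lia).
set p := f _; set q := f _ => np nq np_q.
have -> : S = (q - p) - (q - p - S) by ring.
have := cnormB (q - p) (q - p - S); have := cnormB q p; lra.
Qed.

End Summation.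

(** * Taylor expansion of negative powers *)

Section Taylor.
Variable R : realType.
Local Notation C := R[i].

Definition tcoef (k m : nat) : C := (-1) ^+ m * ('C((k + m).-1, m))%:R.

Lemma tcoef0 k : tcoef k 0 = 1.
Proof. by rewrite /tcoef expr0 bin0 mulr1. Qed.

Lemma tcoefS k m : tcoef k.+1 m.+1 + tcoef k.+1 m = tcoef k m.+1.
Proof.
rewrite /tcoef !addSn !addnS /= binS natrD exprS; ring.
Qed.

Lemma taylor_sum k M : exists x : C, forall u,
  (1 + u) * \sum_(m < M) tcoef k.+1 m * u ^+ m =
  \sum_(m < M) tcoef k m * u ^+ m + x * u ^+ M.
Proof.
exists (if M is M'.+1 then tcoef k.+1 M' else 0) => u.
elim: M => [|M IH]; first by rewrite !big_ord0 mul0r mulr0 addr0.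
rewrite !big_ord_recr /= mulrDr IH.
case: M {IH} => [|M]; first by rewrite !tcoef0 expr0 expr1; ring.
rewrite -(tcoefS k M) !exprS; ring.
Qed.

(** Induction on k: by [taylor_sum], passing to k + 1 adds a multiple of u^M and divides by 1 + u,
    which costs at most a factor 2 since |1 + u| >= 1/2. *)
Lemma taylor_unit k M : exists2 c : R, 0 <= c & forall u : C, cnorm u <= 1 / 2 ->
  cnorm ((1 + u) ^- k - \sum_(m < M) tcoef k m * u ^+ m) <= c * cnorm u ^+ M.
Proof.
elim: k => [|k [c c0 IH]].
  exists 1 => // u _; case: M => [|M].
    by rewrite big_ord0 subr0 expr0 invr1 cnorm1 expr0 mulr1.
  rewrite big_ord_recl /= tcoef0 !expr0 invr1 mulr1 big1 => [|i _].
    by rewrite addr0 subrr cnorm0 mul1r exprn_ge0 // cnorm_ge0.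
  by rewrite /tcoef /bump /= add1n add0n /= bin_small ?mulr0 ?mul0r.
have [x hx] := taylor_sum k M.
exists (2 * (c + cnorm x)) => [|u hu].
  by have := cnorm_ge0 x; lra.
have n1 : 1 / 2 <= cnorm (1 + u).
  have := cnormB (1 + u) u; rewrite addrK cnorm1; lra.
have nz : 1 + u != 0 by rewrite -cnorm_gt0; lra.
set S := \sum_(m < M) _.
have -> : (1 + u) ^- k.+1 - S =
    (((1 + u) ^- k - \sum_(m < M) tcoef k m * u ^+ m) - x * u ^+ M) / (1 + u).
  apply: (mulIf nz); rewrite divfK // mulrBl [S * _]mulrC hx exprS invfM.
  by rewrite mulrAC mulVf // mul1r; ring.
rewrite cnormM cnormV; set P := _ - \sum_(m < M) _.
have i2 : (cnorm (1 + u))^-1 <= 2.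
  by rewrite -[leRHS]invrK lef_pV2 ?posrE //; lra.
have := IH u hu; rewrite -/P => hP.
have := cnormB P (x * u ^+ M); rewrite cnormM cnormX.
set U := cnorm u ^+ M in hP * => h1.
have U0 : 0 <= U by rewrite exprn_ge0 ?cnorm_ge0.
have i0 : 0 <= (cnorm (1 + u))^-1 by rewrite invr_ge0 cnorm_ge0.
have q0 := cnorm_ge0 (P - x * u ^+ M).
rewrite [leRHS](_ : _ = (c * U + cnorm x * U) * 2); last by ring.
by apply: ler_pM => //; lra.
Qed.

Lemma taylor k M : exists2 c : R, 0 <= c & forall p h : C,
  p != 0 -> 2 * cnorm h <= cnorm p ->
  cnorm ((p + h) ^- k - \sum_(m < M) tcoef k m * (p ^- (k + m)%N * h ^+ m)) <=
  c * (cnorm h ^+ M * cnorm p ^- (k + M)).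
Proof.
have [c c0 hc] := taylor_unit k M.
exists c => // p h p0 hp.
have np : 0 < cnorm p by rewrite cnorm_gt0.
have hu : cnorm (h / p) <= 1 / 2.
  by rewrite cnormM cnormV ler_pdivrMr //; lra.
have -> : (p + h) ^- k - \sum_(m < M) tcoef k m * (p ^- (k + m)%N * h ^+ m) =
   p ^- k * ((1 + h / p) ^- k - \sum_(m < M) tcoef k m * (h / p) ^+ m).
  rewrite mulrBr -invfM -exprMn mulrDr mulr1 mulrCA divff // mulr1; congr (_ - _).
  rewrite mulr_sumr; apply: eq_bigr => m _.
  by rewrite exprMn exprD invfM exprVn; ring.
rewrite cnormM cnormV cnormX exprD invfM.
rewrite [leRHS](_ : _ = (cnorm p ^+ k)^-1 * (c * (cnorm (h / p)) ^+ M)).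
  by rewrite ler_wpM2l ?invr_ge0 ?exprn_ge0 ?cnorm_ge0 ?hc.
rewrite cnormM cnormV exprMn exprVn; ring.
Qed.

End Taylor.

(** * A summable weight of exponent 5/4 on the natural numbers *)

Section QuarterPowers.
Variable R : realType.

Definition qroot (x : R) := Num.sqrt (Num.sqrt x).

Lemma qroot_gt0 x : 0 < x -> 0 < qroot x.
Proof. by move=> x0; rewrite !sqrtr_gt0. Qed.

Lemma qrootK x : 0 <= x -> qroot x ^+ 4 = x.
Proof. by move=> x0; rewrite -[4%N]/(2 * 2)%N exprM !sqr_sqrtr ?sqrtr_ge0. Qed.

(* With u^4 = x and v^4 = x + 1 : 1/u - 1/v = 1/(uv(u+v)(u^2+v^2)) >= 1/(4 v^5). *)
Lemma qroot_telescope x : 0 < x ->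
  qroot (x + 1) ^- 5 <= 4 * ((qroot x)^-1 - (qroot (x + 1))^-1).
Proof.
move=> x0; have u0 := qroot_gt0 x0.
have v0 : 0 < qroot (x + 1) by apply: qroot_gt0; lra.
have := qrootK (ltW x0); have := @qrootK (x + 1) ltac:(lra).
have uv : qroot x <= qroot (x + 1) by rewrite !ler_sqrt //; rewrite ?sqrtr_ge0; lra.
move: (qroot x) (qroot (x + 1)) u0 v0 uv => u v u0 v0 uv ev eu.
have e1 : (v - u) * ((u + v) * (u ^+ 2 + v ^+ 2)) = 1.
  have -> : (v - u) * ((u + v) * (u ^+ 2 + v ^+ 2)) = v ^+ 4 - u ^+ 4 by ring.
  lra.
have h1 : v ^- 3 <= 4 * (v - u).
  have v3 : 0 < v ^+ 3 by rewrite exprn_gt0.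
  have h : (u + v) * (u ^+ 2 + v ^+ 2) <= 4 * v ^+ 3.
    rewrite (_ : 4 * v ^+ 3 = (2 * v) * (2 * v ^+ 2)); last by ring.
    by apply: ler_pM; nra.
  rewrite -[leLHS]mul1r ler_pdivrMr //.
  have : (v - u) * ((u + v) * (u ^+ 2 + v ^+ 2)) <= (v - u) * (4 * v ^+ 3).
    by rewrite ler_wpM2l // subr_ge0.
  rewrite e1; lra.
have -> : u^-1 - v^-1 = (v - u) * (u * v)^-1 by field; rewrite !gt_eqF.
rewrite (_ : v ^- 5 = v ^- 3 * (v * v)^-1); last by field; rewrite gt_eqF.
rewrite mulrA ler_pM ?invr_ge0 ?exprn_ge0 ?mulr_ge0 ?(ltW v0) //.
by rewrite lef_pV2 ?posrE ?mulr_gt0 // ler_pM2r.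
Qed.

(** This is (n + 1)^(-5/4). The product of two such weights, in |m| and |n|, dominates |w|^(-5/2) up
    to a constant at a lattice point w of coordinates m and n. *)
Definition qweight (n : nat) : R := qroot (n%:R + 1) ^- 5.

Lemma qweight_gt0 n : 0 < qweight n.
Proof. by rewrite invr_gt0 exprn_gt0 // qroot_gt0 // ltr_wpDl. Qed.

Lemma qweight_sum n : \sum_(k < n) qweight k <= 5.
Proof.
case: n => [|n]; first by rewrite big_ord0.
(* The first term is 1 and each later one is at most 4 times a difference of consecutive inverse
   fourth roots, so 5 = 1 + 4. *)
suff : \sum_(k < n.+1) qweight k <= 5 - 4 * (qroot (n%:R + 1))^-1.
  have : 0 < (qroot (n%:R + 1 : R))^-1 by rewrite invr_gt0 qroot_gt0 // ltr_wpDl.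
  lra.
elim: n => [|n IH].
  by rewrite big_ord_recl big_ord0 /qweight add0r /qroot !sqrtr1 expr1n invr1; lra.
rewrite big_ord_recr /=.
have := @qroot_telescope (n%:R + 1) (ltr_wpDl (ler0n _ _) ltr01).
rewrite /qweight -[n.+1%:R]natr1; lra.
Qed.

End QuarterPowers.

(** * Lattices in the complex plane *)

Section RsummableOff.
Variable R : realType.

Lemma rsummable_le_off (I : eqType) (f g : I -> R) (c : R) (s0 : seq I) :
  0 <= c -> (forall i, 0 <= f i) -> (forall i, 0 <= g i) ->
  (forall i, i \notin s0 -> f i <= c * g i) -> rsummable g -> rsummable f.
Proof.
move=> c0 f0 g0 le [M hM]; exists (\sum_(i <- undup s0) f i + c * M) => s us.
rewrite (bigID (mem s0)) /= lerD // -big_filter.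
  apply: ler_sum_subset; rewrite ?filter_uniq ?undup_uniq // => i.
  by rewrite mem_filter mem_undup => /andP[].
apply: (le_trans (y := \sum_(i <- [seq i <- s | i \notin s0]) c * g i)).
  by rewrite [leRHS]big_filter big_filter; apply: ler_sum => i /le.
by rewrite -mulr_sumr ler_wpM2l ?hM ?filter_uniq.
Qed.

End RsummableOff.

Section Lattice.
Variable R : realType.
Local Notation C := R[i].
Local Notation I := (int * int)%type.

Definition lat (a b : C) (i : I) : C := a *~ i.1 + b *~ i.2.

Arguments lat : simpl never.

(** |z|^(-5/2): the exponent exceeds 2, so its lattice sum converges; it is below 3, so it dominates
    the powers [z ^- k] with k >= 3 when |z| >= 1; and two such weights have total degree -5, that
    of the double series for E_3 P. *)
Definition hweight (z : C) : R := Num.sqrt (cnorm z) ^- 5.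

Lemma hweight_ge0 z : 0 <= hweight z.
Proof. by rewrite invr_ge0 exprn_ge0 // sqrtr_ge0. Qed.

Lemma hweight_le k z : (2 < k)%N -> 1 <= cnorm z -> cnorm (z ^- k) <= hweight z.
Proof.
move=> k3 z1; rewrite cnormV cnormX.
have s1 : 1 <= Num.sqrt (cnorm z) by rewrite -[leLHS]sqrtr1 ler_sqrt //; lra.
rewrite -{1}(sqr_sqrtr (cnorm_ge0 z)) -exprM.
rewrite lef_pV2 ?posrE ?exprn_gt0 ?ler_weXn2l //; try lra.
by lia.
Qed.

Variables a b : C.
Hypothesis ab : b / a \isn't Num.real.
Local Notation L := (lat a b).

Lemma latD i j : L (i + j) = L i + L j.
Proof. by rewrite /lat /= !mulrzDr addrACA. Qed.

Lemma lat0 : L 0 = 0.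
Proof. by rewrite /lat /= !mulr0z addr0. Qed.

Lemma latN i : L (- i) = - L i.
Proof. by rewrite /lat /= !mulrNz opprD. Qed.

Lemma lat_neq0 : a != 0.
Proof. by apply: contraNneq ab => ->; rewrite invr0 mulr0 real0. Qed.

(** With tau = b/a, the imaginary part of m + n tau is n Im tau, which bounds n; the triangle
    inequality then bounds m. *)
Lemma lat_lower : exists2 c : R, 0 < c &
  forall i, c * (`|i.1|%N%:R + `|i.2|%N%:R) <= cnorm (L i).
Proof.
have a0 := lat_neq0; have ab' := ab; set tau := b / a in ab'.
have y0 : 0 < `|complex.Im tau|.
  by rewrite normr_gt0; move: ab'; case: tau => x y; rewrite complex_real.
set y := `|complex.Im tau| in y0.
have t0 := cnorm_ge0 tau.
have D0 : 0 < 1 + (1 + cnorm tau) / y.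
  by rewrite ltr_pwDl // divr_ge0 ?(ltW y0) //; lra.
have pa : 0 < cnorm a by rewrite cnorm_gt0.
exists (cnorm a / (1 + (1 + cnorm tau) / y)) => [|[m n]]; first exact: divr_gt0.
have {a0 ab'} -> : L (m, n) = a * (m%:~R + n%:~R * tau).
  by rewrite /lat /= mulrDr mulrzr mulrCA mulrzl /tau mulrCA divff // mulr1.
clearbody tau; rewrite (cnormM a) -mulrA ler_pM2l // mulrC ler_pdivrMr //=.
set z := m%:~R + _ * tau.
have nE (k : int) : cnorm (k%:~R : C) = `|k|%N%:R.
  by apply: complexI; rewrite cnormE -intr_norm -abszE -pmulrn rmorph_nat.
have imz : complex.Im z = n%:~R * complex.Im tau.
  rewrite /z -!(rmorph_int (real_complex R)).
  by case: (tau) => u v; simpc.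
have h1 : `|n|%N%:R * y <= cnorm z.
  have := Im_le_cnorm z; rewrite imz normrM.
  suff -> : `|n%:~R| = `|n|%N%:R :> R by [].
  by rewrite -intr_norm -abszE -pmulrn.
have h2 : `|m|%N%:R <= cnorm z + `|n|%N%:R * cnorm tau.
  rewrite -!nE -cnormM; have := cnormB z (n%:~R * tau).
  by rewrite /z addrK.
have h3 : `|n|%N%:R <= cnorm z / y by rewrite ler_pdivlMr.
have -> : cnorm z * (1 + (1 + cnorm tau) / y) =
  cnorm z + cnorm z / y * cnorm tau + cnorm z / y by ring.
have : `|n|%N%:R * cnorm tau <= cnorm z / y * cnorm tau by rewrite ler_wpM2r.
lra.
Qed.

Lemma lat_inj : injective L.
Proof.
have [c c0 h] := lat_lower.
move=> i j eq; have := h (i - j); rewrite latD latN eq subrr cnorm0.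
have x0 : (0 : R) <= (absz (i - j).1)%:R by [].
have y0 : (0 : R) <= (absz (i - j).2)%:R by [].
move=> le0; have e1 : ((absz (i - j).1)%:R : R) = 0 by nra.
have e2 : ((absz (i - j).2)%:R : R) = 0 by nra.
move/eqP: e1; move/eqP: e2; rewrite !pnatr_eq0 !absz_eq0 /= !subr_eq0.
by case: i j {x0 y0 le0 eq} => ? ? [? ?] /= /eqP -> /eqP ->.
Qed.

Definition boxs (K : nat) : seq I :=
  let s := [seq k%:Z - K%:Z | k <- iota 0 (K + K).+1] in allpairs pair s s.

Lemma mem_boxs K i : i \notin boxs K -> (K < `|i.1|)%N || (K < `|i.2|)%N.
Proof.
apply: contraR; rewrite negb_or -!leqNgt => /andP[h1 h2].
have h (m : int) : (`|m| <= K)%N -> m \in [seq k%:Z - K%:Z | k <- iota 0 (K + K).+1].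
  move=> mK; apply/mapP; exists (absz (m + K%:Z)).
    by rewrite mem_iota /= add0n; lia.
  by lia.
by apply/allpairsP; exists i; rewrite !h //; split => //; case: (i).
Qed.

Lemma lat_off_disc (z : C) (r : R) :
  exists s0 : seq I, forall i, i \notin s0 -> r <= cnorm (z + L i).
Proof.
have [c c0 h] := lat_lower.
have z0 := cnorm_ge0 z.
set K := Num.bound ((`|r| + cnorm z) / c).
exists (boxs K) => i /mem_boxs hi.
have hK : (`|r| + cnorm z) / c < K%:R.
  by apply: le_lt_trans (archi_boundP _); rewrite ?divr_ge0 ?addr_ge0 ?(ltW c0).
have hi' : (K%:R : R) <= `|i.1|%N%:R + `|i.2|%N%:R.
  by rewrite -natrD ler_nat; lia.
rewrite ltr_pdivrMr // in hK.
have : K%:R * c <= (`|i.1|%N%:R + `|i.2|%N%:R) * c by rewrite ler_pM2r.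
have := h i; have := cnormB (z + L i) z; rewrite addrAC subrr add0r.
have := ler_norm r; lra.
Qed.

Lemma lat_hweight z : rsummable (fun i => hweight (z + L i)).
Proof.
have [c c0 h] := lat_lower.
have [s0 hs0] := lat_off_disc 0 (2 * cnorm z).
have z0 := cnorm_ge0 z.
apply: (rsummable_le_off (c := Num.sqrt (c / 4) ^- 5) (s0 := boxs 2 ++ s0)
  (g := fun i => qweight R `|i.1|%N * qweight R `|i.2|%N)).
- by rewrite invr_ge0 exprn_ge0 // sqrtr_ge0.
- by move=> i; exact: hweight_ge0.
- by move=> i; rewrite mulr_ge0 // ltW // qweight_gt0.
- move=> i; rewrite mem_cat negb_or => /andP[/mem_boxs h1 /hs0].
  rewrite add0r => h2.
  set m : R := `|i.1|%N%:R; set n : R := `|i.2|%N%:R.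
  have m0 : 0 <= m by []. have n0 : 0 <= n by [].
  have mn : 2 <= m + n by rewrite -natrD (ler_nat _ 2); lia.
  (* At least half of |L i| survives the shift by z, and sqrt((m + 1)(n + 1)) <= (m + n + 2)/2 <= m
     + n because the removal of [boxs 2] gives m + n >= 2. *)
  have low : c / 4 * Num.sqrt ((m + 1) * (n + 1)) <= cnorm (z + L i).
    have s2 : Num.sqrt ((m + 1) * (n + 1)) <= m + n.
      rewrite -[leRHS]ger0_norm; last lra.
      have d0 : 0 <= (m - n) ^+ 2 := sqr_ge0 _.
      have d1 : (m + n + 2) * (m + n + 2) <= (2 * (m + n)) * (2 * (m + n)).
        by apply: ler_pM; lra.
      by rewrite -sqrtr_sqr ler_sqrt ?sqr_ge0 //; nra.
    have := h i; rewrite -/m -/n => hi.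
    have := cnormB (z + L i) z; rewrite addrAC subrr add0r => hz.
    have : c * Num.sqrt ((m + 1) * (n + 1)) <= c * (m + n) by rewrite ler_pM2l.
    have : 0 <= c * (m + n) by rewrite mulr_ge0; lra.
    lra.
  rewrite /qweight /qroot -!invfM -!exprMn /hweight -/m -/n.
  have p1 : 0 < Num.sqrt (m + 1) by rewrite sqrtr_gt0; lra.
  have p2 : 0 < Num.sqrt (n + 1) by rewrite sqrtr_gt0; lra.
  have p3 : 0 < Num.sqrt (c / 4) by rewrite sqrtr_gt0; lra.
  rewrite -!sqrtrM ?sqrtr_ge0 //; try lra.
  have q0 : 0 < c / 4 * Num.sqrt ((m + 1) * (n + 1)).
    by rewrite mulr_gt0 ?sqrtr_gt0 ?mulr_gt0; lra.
  rewrite lef_pV2 ?posrE ?exprn_gt0 ?sqrtr_gt0 ?(lt_le_trans q0) //.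
  rewrite lerXn2r ?nnegrE ?sqrtr_ge0 // ler_sqrt //.
  exact: le_trans (ltW q0) _.
have qs : rsummable (fun m : int => qweight R `|m|%N).
  by apply: (rsummable_int (M := 5)) => n; rewrite ?qweight_sum ?ltW ?qweight_gt0.
by apply: (rsummable_prod _ _ qs qs) => n; rewrite ltW ?qweight_gt0.
Qed.

Lemma lat_summable z k : (2 < k)%N -> summable (fun i => (z + L i) ^- k).
Proof.
move=> k3; have [s0 hs0] := lat_off_disc z 1.
apply: (rsummable_le_off (c := 1) (s0 := s0)) (lat_hweight z) => // i.
- exact: cnorm_ge0.
- exact: hweight_ge0.
- by move=> /hs0 h; rewrite mul1r hweight_le.
Qed.

Lemma lat_gap z : exists2 d : R, 0 < d &
  forall i, z + L i != 0 -> d <= cnorm (z + L i).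
Proof.
have [s0 hs0] := lat_off_disc z 1.
have [d d0 hd] : exists2 d : R, 0 < d &
    forall i, i \in s0 -> z + L i != 0 -> d <= cnorm (z + L i).
  elim: s0 {hs0} => [|j s0 [d d0 IH]]; first by exists 1.
  have [e|ne] := eqVneq (z + L j) 0.
    by exists d => // i; rewrite inE => /predU1P[->|/IH//]; rewrite e eqxx.
  exists (Num.min d (cnorm (z + L j))); first by rewrite lt_min d0 cnorm_gt0.
  move=> i; rewrite inE => /predU1P[->|/IH h /h]; rewrite ge_min ?lexx ?orbT //.
  by move=> ->.
exists (Num.min d 1); first by rewrite lt_min d0 ltr01.
move=> i nz; rewrite ge_min; case: (boolP (i \in s0)) => [/hd->//|/hs0->].
by rewrite orbT.
Qed.

End Lattice.

(** * Eisenstein sums and the Weierstrass function *)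

Section Tsum.
Variable R : realType.
Local Notation C := R[i].

Definition tsum (I : eqType) (f : I -> C) : C := xget 0 [set S | hassum f S]%classic.

Lemma hassum_tsum (I : eqType) (f : I -> C) S : hassum f S -> tsum f = S.
Proof. by rewrite /tsum; case: xgetP => [T _ hT|h /h//] hS; exact: hassum_unique hS. Qed.

Lemma summableP (I : eqType) (f : I -> C) : summable f -> hassum f (tsum f).
Proof. by move=> /summable_hassum[S hS]; rewrite (hassum_tsum hS). Qed.

Lemma eq_summable (I : eqType) (f g : I -> C) : f =1 g -> summable f -> summable g.
Proof. by move=> /funext ->. Qed.

Lemma summableD (I : eqType) (f g : I -> C) :
  summable f -> summable g -> summable (fun i => f i + g i).
Proof.
move=> hf hg; apply: (rsummable_le (c := 1)) (rsummableD hf hg) => // i.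
by rewrite mul1r cnormD.
Qed.

Lemma summableB (I : eqType) (f g : I -> C) :
  summable f -> summable g -> summable (fun i => f i - g i).
Proof.
move=> hf hg; apply: (rsummable_le (c := 1)) (rsummableD hf hg) => // i.
by rewrite mul1r cnormB.
Qed.

Definition vanishing (I : eqType) (f : I -> C) : Prop :=
  forall e : R, 0 < e -> exists s0 : seq I, forall i, i \notin s0 -> cnorm (f i) < e.

Lemma vanishingD (I : eqType) (f g : I -> C) :
  vanishing f -> vanishing g -> vanishing (fun i => f i + g i).
Proof.
move=> hf hg e e0; have [s1 h1] := hf (e / 2) ltac:(lra).
have [s2 h2] := hg (e / 2) ltac:(lra); exists (s1 ++ s2) => i.
rewrite mem_cat negb_or => /andP[/h1 a1 /h2 a2].
by have := cnormD (f i) (g i); lra.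
Qed.

Lemma vanishingZ (I : eqType) (f : I -> C) c :
  vanishing f -> vanishing (fun i => c * f i).
Proof.
move=> hf e e0; have c0 := cnorm_ge0 c.
have [|s h] := hf (e / (cnorm c + 1)); first by rewrite divr_gt0 //; lra.
exists s => i /h; rewrite ltr_pdivlMr; last lra.
rewrite cnormM; have := cnorm_ge0 (f i); nra.
Qed.

Lemma vanishing_bij (I J : eqType) (phi : I -> J) (psi : J -> I) (f : J -> C) :
  cancel phi psi -> vanishing f -> vanishing (f \o phi).
Proof.
move=> h1 hf e e0; have [s h] := hf e e0; exists (map psi s) => i ni.
by apply: h; apply: contra ni => hs; rewrite -(h1 i) map_f.
Qed.

End Tsum.

(** * Telescoping sums along the cosets of a cyclic group of indices *)

Section TelescopeLattice.
Variable R : realType.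
Local Notation C := R[i].
Local Notation I := (int * int)%type.

(* Coordinate along [j] of the decomposition of the index group into
   translates of the multiples of [j]. *)
Let coord (j i : I) : int := if j.1 != 0 then (i.1 %/ j.1)%Z else (i.2 %/ j.2)%Z.

Let coordD (j i : I) (m : int) : j != 0 -> coord j (i + j *~ m) = coord j i + m.
Proof.
have e1 : (j *~ m).1 = m * j.1 by rewrite (raddfMz fst) /= mulrzz mulrC.
have e2 : (j *~ m).2 = m * j.2 by rewrite (raddfMz snd) /= mulrzz mulrC.
move=> j0; rewrite /coord /= e1 e2; case: eqVneq => [j1|j1] /=.
  rewrite [_ + m * _]addrC divzMDl 1?addrC //.
  by apply: contraNneq j0 => j2; case: (j) j1 j2 => x y /= -> ->.
by rewrite [_ + m * _]addrC divzMDl 1?addrC.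
Qed.

(** The absolutely convergent sum of the differences is regrouped by cosets of Z j, and each coset
    gives a telescoping sum over Z. Only a limit 0 is asked of f itself, so that inverse first and
    second powers are allowed. *)
Lemma lattice_telescope (f : I -> C) (j : I) :
  j != 0 -> summable (fun i => f i - f (i - j)) -> vanishing f ->
  hassum (fun i => f i - f (i - j)) 0.
Proof.
move=> j0 sg vf; have hS := summableP sg; set S := tsum _ in hS.
suff <- : S = 0 by [].
pose g i := f i - f (i - j).
(* Each coset is represented by its elements with [coord] 0; extension by 0 makes the index set a
   product, as [hassum_fubini] requires. *)
pose g' (k : I * int) := if coord j k.1 == 0 then g (k.1 + j *~ k.2) else 0.
have hg' : hassum g' S.
  pose phi i : I * int := (i - j *~ coord j i, coord j i).
  pose psi (k : I * int) := if coord j k.1 == 0 then Some (k.1 + j *~ k.2) else None.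
  have c0 i : coord j (i - j *~ coord j i) = 0.
    by rewrite -mulrNz coordD // subrr.
  apply: (hassum_pinj (phi := phi) (psi := psi)).
  - by move=> i; rewrite /psi /phi /= c0 eqxx subrK.
  - move=> [i m] k; rewrite /psi /phi /=; case: eqP => // ci [<-].
    by rewrite coordD // ci add0r addrK.
  - by move=> k; rewrite /psi /g'; case: eqP.
  - by apply: eq_hassum hS => i; rewrite /g' /phi /= c0 eqxx subrK.
apply/esym/(hassum_unique (@hassum0 R I)); apply: (hassum_fubini hg') => i.
rewrite /g' /=; have [ci|ci] := eqVneq; last exact: hassum0.
have inj : injective (fun m : int => i + j *~ m).
  by move=> m m' /(congr1 (coord j)); rewrite !coordD // => /addrI.
have hs : summable (fun m : int => g (i + j *~ m)) by apply: rsummable_inj inj sg.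
have h := summableP hs.
suff <- : tsum (fun m : int => g (i + j *~ m)) = 0 by [].
apply: (hassum_telescope (f := fun m => f (i + j *~ m))).
  by apply: eq_hassum h => m; rewrite /g mulrzBr mulr1z addrA.
move=> e e0; have [s0 hs0] := vf e e0.
exists (map (coord j) s0) => m; apply: contraR; rewrite -leNgt => hm.
have : i + j *~ m \in s0 by apply: contraTT hm => /hs0; rewrite -ltNge.
by move=> /(map_f (coord j)); rewrite coordD // ci add0r.
Qed.

End TelescopeLattice.

Section Eisenstein.
Variable R : realType.
Local Notation C := R[i].
Local Notation I := (int * int)%type.
Variables a b : C.
Hypothesis ab : b / a \isn't Num.real.
Local Notation L := (lat a b).

(* As 0^-1 = 0, the value [eis k 0] is the Eisenstein series G_k. *)
Definition eis (k : nat) (z : C) : C := tsum (fun i => (z + L i) ^- k).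
(** The polar term z^-2 is included: at i = 0 the subtracted [L i ^- 2] is 0, since 0^-1 = 0. *)
Definition wp (z : C) : C := tsum (fun i => (z + L i) ^- 2 - L i ^- 2).

Lemma eisP k z : (2 < k)%N -> hassum (fun i => (z + L i) ^- k) (eis k z).
Proof. by move=> k3; apply: summableP; apply: lat_summable. Qed.

Lemma wp_summable z : summable (fun i => (z + L i) ^- 2 - L i ^- 2).
Proof.
have [c c0 hc] := @taylor R 2 1.
have [s0 hs0] := lat_off_disc ab 0 (2 * cnorm z + 1).
have z0 := cnorm_ge0 z.
apply: (rsummable_le_off (c := c * cnorm z) (s0 := s0)) (lat_hweight ab 0).
- by rewrite mulr_ge0.
- by move=> i; exact: cnorm_ge0.
- by move=> i; exact: hweight_ge0.
- move=> i /hs0; rewrite add0r => hi.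
  have /hc : L i != 0 by rewrite -cnorm_gt0; lra.
  move=> /(_ z ltac:(lra)); rewrite big_ord1 tcoef0 expr0 mul1r mulr1 expr1.
  rewrite (addrC (L i)) => /le_trans; apply.
  rewrite -mulrA ler_wpM2l // ler_wpM2l // -cnormX -cnormV hweight_le //; lra.
Qed.

Lemma wpP z : hassum (fun i => (z + L i) ^- 2 - L i ^- 2) (wp z).
Proof. exact/summableP/wp_summable. Qed.

Lemma shift_bij (j : I) : cancel (+%R^~ j) (fun i => i - j) /\
  cancel (fun i => i - j) (+%R^~ j).
Proof. by split=> i; rewrite ?addrK ?subrK. Qed.

Lemma eis_period k z j : (2 < k)%N -> eis k (z + L j) = eis k z.
Proof.
move=> k3; apply: hassum_tsum.
have [h1 h2] := shift_bij j.
apply: eq_hassum (hassum_bij h1 h2 (eisP z k3)) => i /=.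
by rewrite latD [L i + _]addrC addrA.
Qed.

Lemma eisN k z : (2 < k)%N -> eis k (- z) = (-1) ^+ k * eis k z.
Proof.
move=> k3; apply: hassum_tsum.
apply: eq_hassum (hassumZ ((-1) ^+ k) (hassum_bij (@opprK I) (@opprK I) (eisP z k3))).
move=> i /=; rewrite latN.
have -> : - z + L i = - (z - L i) by ring.
by rewrite [in RHS]exprNn invfM invr_sign.
Qed.

Lemma wpN z : wp (- z) = wp z.
Proof.
apply: hassum_tsum.
apply: eq_hassum (hassum_bij (@opprK I) (@opprK I) (wpP z)) => i /=.
have -> : - z + L i = - (z - L i) by ring.
by rewrite latN !sqrrN.
Qed.

Lemma lat_vanishing z k : (0 < k)%N -> vanishing (fun i => (z + L i) ^- k).
Proof.
move=> k0 e e0; have [s0 hs0] := lat_off_disc ab z (e^-1 + 1).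
have ei : 0 < e^-1 by rewrite invr_gt0.
exists s0 => i /hs0 h; rewrite cnormV cnormX.
have h1 : e^-1 < cnorm (z + L i) by lra.
rewrite -[ltRHS]invrK ltf_pV2 ?posrE ?exprn_gt0 //; try lra.
apply: (lt_le_trans h1); case: k k0 => // k _.
by rewrite exprS ler_peMr ?cnorm_ge0 // exprn_ege1 //; lra.
Qed.

(** Subtracting the two series term by term leaves f i - f (i - j), where f is an inverse square and
    hence tends to 0, so [lattice_telescope] applies. *)
Lemma wp_period z j : wp (z + L j) = wp z.
Proof.
have [->|j0] := eqVneq j 0; first by rewrite lat0 addr0.
apply/eqP; rewrite -subr_eq0; apply/eqP.
have [h1 h2] := shift_bij j.
pose f i := (z + L (i + j)) ^- 2.
have e i : (z + L j + L i) ^- 2 - L i ^- 2 - ((z + L i) ^- 2 - L i ^- 2) = f i - f (i - j).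
  have -> : z + L j + L i = z + L (i + j) by rewrite latD; ring.
  by rewrite /f subrK opprB addrA subrK.
apply: (@hassum_unique _ _ (fun i => f i - f (i - j))).
  exact: eq_hassum e (hassumB (wpP _) (wpP _)).
apply: lattice_telescope => //.
  exact: eq_summable e (summableB (wp_summable (z + L j)) (wp_summable z)).
exact: (vanishing_bij h1 (lat_vanishing z (isT : 0 < 2)%N)).
Qed.

(** Common source of the Laurent expansions at z = 0, where the polar term is left out, and of the
    derivatives off the lattice. Subtracting [(z + L i) ^- k] cancels the Taylor term of order 0,
    hence [M.-1] terms in the sum. *)
Lemma lat_expansion k M z : (1 < k)%N -> (0 < M)%N -> (2 < k + M)%N ->
  exists2 d : R, 0 < d & exists2 c : R, 0 <= c & forall h : C, cnorm h <= d ->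
  exists2 V, hassum (fun i => if z + L i == 0 then 0
                    else (z + L i + h) ^- k - (z + L i) ^- k) V &
  cnorm (V - \sum_(m < M.-1) tcoef R k m.+1 * (eis (k + m.+1) z * h ^+ m.+1)) <=
    c * cnorm h ^+ M.
Proof.
move=> k2 M0 kM; have [c c0 hc] := @taylor R k M.
have [d d0 hd] := lat_gap ab z.
have [B hB] := lat_summable ab z kM.
exists (d / 2); first lra.
exists (c * `|B|); first by rewrite mulr_ge0.
move=> h hh.
pose T i := \sum_(m < M.-1) tcoef R k m.+1 * ((z + L i) ^- (k + m.+1) * h ^+ m.+1).
pose F i := if z + L i == 0 then 0 else (z + L i + h) ^- k - (z + L i) ^- k.
have hT : hassum T (\sum_(m < M.-1) tcoef R k m.+1 * (eis (k + m.+1) z * h ^+ m.+1)).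
  apply: hassum_sum => m; apply: hassumZ.
  under [fun i => _]funext => i do rewrite mulrC.
  by rewrite mulrC; apply: hassumZ; apply: eisP; lia.
(* If z + L i = 0, every term of [T i] vanishes too because 0^-1 = 0; so the full sums [eis] may
   appear in the expansion. *)
have bF i : cnorm (F i - T i) <= c * cnorm h ^+ M * cnorm ((z + L i) ^- (k + M)).
  rewrite /F /T; case: eqVneq => [->|nz].
    rewrite big1 ?subrr ?cnorm0; last first.
      by move=> m _; rewrite expr0n addnS invr0 mul0r mulr0.
    by rewrite !mulr_ge0 ?exprn_ge0 ?cnorm_ge0.
  have := hc _ h nz; have := hd _ nz => h1 /(_ ltac:(lra)).
  rewrite cnormV cnormX mulrA => /(le_trans _); apply.
  case: (M) M0 => // M' _; rewrite big_ord_recl tcoef0 addn0 expr0 mul1r mulr1.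
  by rewrite opprD [in leRHS]addrA.
have sFT : summable (fun i => F i - T i).
  apply: (rsummable_le (c := c * cnorm h ^+ M)) bF _; last by exists B.
  by rewrite mulr_ge0 ?exprn_ge0 ?cnorm_ge0.
have hW := summableP sFT; set W := tsum _ in hW.
exists (W + \sum_(m < M.-1) tcoef R k m.+1 * (eis (k + m.+1) z * h ^+ m.+1)).
  by apply: eq_hassum (hassumD hW hT) => i; rewrite subrK.
rewrite addrK; apply: hassum_norm_le hW => s us.
apply: (le_trans (y := \sum_(i <- s) c * cnorm h ^+ M * cnorm ((z + L i) ^- (k + M)))).
  by apply: ler_sum => i _; exact: bF.
rewrite -mulr_sumr mulrAC ler_wpM2r ?exprn_ge0 ?cnorm_ge0 //.
by rewrite ler_wpM2l // (le_trans (hB _ us)) // ler_norm.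
Qed.

End Eisenstein.

(** * The product of E_3 and P *)

Section ProductBound.
Variable R : realType.
Local Notation C := R[i].

(** If w exceeds x or y, the triangle inequalities give x y <= 2 w^2 and the first product suffices.
    Otherwise w is the smallest side, x <= 2 y and w^3 <= y^3, and the last product suffices. *)
Lemma triangle_weights (x y w : R) : 0 < x -> 0 < y -> 0 < w ->
  x <= y + w -> y <= x + w -> w <= x + y ->
  x ^- 4 * y ^- 4 * w ^- 2 <=
  2 * (x ^- 5 * y ^- 5 + y ^- 5 * w ^- 5 + x ^- 5 * w ^- 5).
Proof.
move=> x0 y0 w0 xyw yxw wxy.
have px : 0 < x ^- 5 by rewrite invr_gt0 exprn_gt0.
have py : 0 < y ^- 5 by rewrite invr_gt0 exprn_gt0.
have pw : 0 < w ^- 5 by rewrite invr_gt0 exprn_gt0.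
have hxy : 0 < x ^- 5 * y ^- 5 by rewrite mulr_gt0.
have hyw : 0 < y ^- 5 * w ^- 5 by rewrite mulr_gt0.
have hxw : 0 < x ^- 5 * w ^- 5 by rewrite mulr_gt0.
have [nx ny nw] : [/\ x != 0, y != 0 & w != 0] by rewrite !gt_eqF.
have case1 : x * y <= 2 * (w * w) -> x ^- 4 * y ^- 4 * w ^- 2 <= 2 * (x ^- 5 * y ^- 5).
  move=> h.
  have -> : x ^- 4 * y ^- 4 * w ^- 2 = (x * y) * (x ^- 5 * y ^- 5 * w ^- 2).
    by field; rewrite nx ny nw.
  have -> : 2 * (x ^- 5 * y ^- 5) = (2 * (w * w)) * (x ^- 5 * y ^- 5 * w ^- 2).
    by field; rewrite nx ny nw.
  rewrite ler_wpM2r // mulr_ge0 ?(ltW hxy) //.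
  by rewrite invr_ge0 exprn_ge0 // ltW.
have [wx|xw] := leP w x; have [wy|yw] := leP w y.
- have -> : x ^- 4 * y ^- 4 * w ^- 2 = (x * (w * (w * w))) * (x ^- 5 * y ^- 4 * w ^- 5).
    by field; rewrite nx ny nw.
  have hw : x ^- 5 * w ^- 5 = (y * (y * (y * y))) * (x ^- 5 * y ^- 4 * w ^- 5).
    by field; rewrite nx ny nw.
  suff : x * (w * (w * w)) * (x ^- 5 * y ^- 4 * w ^- 5) <= 2 * (x ^- 5 * w ^- 5) by lra.
  have g0 : 0 <= x ^- 5 * y ^- 4 * w ^- 5.
    by rewrite !mulr_ge0 ?invr_ge0 ?exprn_ge0 ?(ltW x0) ?(ltW y0) ?(ltW w0).
  rewrite hw [leRHS]mulrA ler_wpM2r // [leRHS]mulrA.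
  by apply: ler_pM; rewrite ?ler_pM ?mulr_ge0 ?(ltW x0) ?(ltW w0) //; lra.
- by have := case1 ltac:(nra); lra.
- by have := case1 ltac:(nra); lra.
- by have := case1 ltac:(nra); lra.
Qed.

Lemma sqrt_subadd (x y w : R) : 0 <= x -> 0 <= y -> w <= x + y ->
  Num.sqrt w <= Num.sqrt x + Num.sqrt y.
Proof.
move=> x0 y0 h; have s0 := sqrtr_ge0 x; have t0 := sqrtr_ge0 y.
rewrite -[leRHS]ger0_norm ?addr_ge0 // -sqrtr_sqr ler_sqrt ?sqr_ge0 //.
rewrite sqrrD !sqr_sqrtr //.
have : 0 <= Num.sqrt x * Num.sqrt y by rewrite mulr_ge0.
by rewrite -mulr_natl; lra.
Qed.

(** With q = p + r, the difference q^-2 - r^-2 contains a factor p, which lowers the pole p^-3 to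
    p^-2. The two resulting terms fall under [triangle_weights], applied to the square roots of |p|,
    |q|, |r|, which again satisfy the triangle inequalities. *)
Lemma hweight_product (p r : C) : p != 0 -> p + r != 0 ->
  cnorm (p ^- 3 * ((p + r) ^- 2 - r ^- 2)) <=
  4 * (hweight p * hweight (p + r) + hweight (p + r) * hweight r +
       hweight p * hweight r).
Proof.
move=> p0; set q := p + r => q0.
have sq (u : C) : cnorm u = Num.sqrt (cnorm u) ^+ 2 by rewrite sqr_sqrtr ?cnorm_ge0.
have spos (u : C) : u != 0 -> 0 < Num.sqrt (cnorm u) by rewrite sqrtr_gt0 cnorm_gt0.
have [r0|r0] := eqVneq r 0.
  rewrite /q r0 addr0 expr0n invr0 subr0 /hweight cnorm0 sqrtr0 expr0n invr0.
  rewrite !mulr0 !addr0 -invfM -exprD cnormV cnormX {1}(sq p) -exprM.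
  have := spos _ p0; move: (Num.sqrt _) => x x0.
  have -> : x ^- (2 * (3 + 2)) = x ^- 5 * x ^- 5 by rewrite -invfM -exprD.
  have : 0 < x ^- 5 * x ^- 5 by rewrite mulr_gt0 ?invr_gt0 ?exprn_gt0.
  lra.
have -> : p ^- 3 * (q ^- 2 - r ^- 2) = - (p ^- 2 * q ^- 1 * r ^- 2 + p ^- 2 * q ^- 2 * r ^- 1).
  by rewrite /q; field; rewrite r0 p0 -/q q0.
rewrite cnormN; apply: (le_trans (cnormD _ _)).
rewrite !cnormM !cnormV !cnormX !expr1 (sq p) (sq q) (sq r) -!exprM /hweight.
have pq := sqrt_subadd (cnorm_ge0 p) (cnorm_ge0 r) (cnormD p r).
have qr : Num.sqrt (cnorm p) <= Num.sqrt (cnorm q) + Num.sqrt (cnorm r).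
  apply: sqrt_subadd; rewrite ?cnorm_ge0 //.
  by have := cnormB q r; rewrite /q addrK.
have rp : Num.sqrt (cnorm r) <= Num.sqrt (cnorm q) + Num.sqrt (cnorm p).
  apply: sqrt_subadd; rewrite ?cnorm_ge0 //.
  by have := cnormB q p; rewrite /q addrAC subrr add0r.
have := spos _ p0; have := spos _ q0; have := spos _ r0.
rewrite -/q in pq; move: pq qr rp.
move: (Num.sqrt (cnorm p)) (Num.sqrt (cnorm q)) (Num.sqrt (cnorm r)) => x y w.
move=> h1 h2 h3 w0 y0 x0.
have := triangle_weights x0 y0 w0 ltac:(lra) ltac:(lra) ltac:(lra).
have := triangle_weights x0 w0 y0 ltac:(lra) ltac:(lra) ltac:(lra).
rewrite /= (mulrC (w ^- 5)) (mulrAC _ (w ^- 4)).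
lra.
Qed.

End ProductBound.

Section Eisenstein.
Variable R : realType.
Local Notation C := R[i].
Local Notation I := (int * int)%type.
Variables a b : C.
Hypothesis ab : b / a \isn't Num.real.
Local Notation L := (lat a b).
Local Notation eis := (eis a b).
Local Notation wp := (wp a b).

Section Product.
Variable z : C.
Hypothesis zL : forall i, z + L i != 0.

Let F (k : I * I) : C :=
  (z + L k.1) ^- 3 * ((z + L k.1 + L k.2) ^- 2 - L k.2 ^- 2).

Let F_summable : summable F.
Proof.
pose w1 (k : I * I) := hweight (z + L k.1) * hweight (0 + L k.2).
pose w2 (k : I * I) := hweight (z + L k.1) * hweight (z + L k.2).
have s1 : rsummable w1.
  by apply: (rsummable_prod _ _ (lat_hweight ab z) (lat_hweight ab 0)) => i;
    exact: hweight_ge0.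
have s2 : rsummable w2.
  by apply: (rsummable_prod _ _ (lat_hweight ab z) (lat_hweight ab z)) => i;
    exact: hweight_ge0.
(* Shears of the index group turn the products of weights at p, p + r and r into products of weights
   at independent indices. *)
have i1 : injective (fun k : I * I => (k.1 + k.2, k.2)).
  move=> [i j] [i' j'] e; have ej : j = j' := congr1 snd e.
  by have := congr1 fst e; rewrite /= ej => /addIr ->.
have i2 : injective (fun k : I * I => (k.1, k.1 + k.2)).
  move=> [i j] [i' j'] e; have ei : i = i' := congr1 fst e.
  by have := congr1 snd e; rewrite /= ei => /addrI ->.
have s := rsummableD (rsummableD (rsummable_inj i2 s2) (rsummable_inj i1 s1)) s1.
apply: (rsummable_le (c := 4)) s => // -[i j].
rewrite /F /w1 /w2 /= !add0r -addrA -latD.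
by have := hweight_product (r := L j) (zL i); rewrite -addrA -latD; apply.
Qed.

(** Partial fractions in p = z + L i. In [F (i, j)] alone the coefficients of the double poles add
    up to -3 r^-3, which prevents telescoping; this is odd in r and disappears in the pair, while
    the simple poles have total residue 0. [K] is the resulting primitive for the shift by r. *)
Let F_pair (j : I) : j != 0 ->
  hassum (fun i => F (i, j) + F (i, - j)) 0.
Proof.
move=> j0; set r := L j.
have r0 : r != 0 by apply: contra j0 => /eqP e; apply/eqP/(lat_inj ab); rewrite lat0.
pose K i := - r ^- 3 * (z + L i) ^- 2 + (- r ^- 3 * (z + r + L i) ^- 2 +
  (3 * r ^- 4 * (z + L i) ^- 1 + - (3 * r ^- 4) * (z + r + L i) ^- 1)).
have vK : vanishing K.
  have v c u k (k0 : (0 < k)%N) := vanishingZ c (lat_vanishing ab u k0).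
  exact: vanishingD (v _ z 2 isT) (vanishingD (v _ (z + r) 2 isT)
    (vanishingD (v _ z 1 isT) (v _ (z + r) 1 isT))).
have e i : K i - K (i - j) = F (i, j) + F (i, - j).
  rewrite /K /F /= latD !latN -/r !expr1.
  have -> : z + r + (L i - r) = z + L i by ring.
  have -> : z + r + L i = z + L i + r by ring.
  have -> : z + (L i - r) = z + L i - r by ring.
  have q1 : z + L i + r != 0 by rewrite -addrA -latD.
  have q2 : z + L i - r != 0 by rewrite -addrA -latN -latD.
  have p0 := zL i; move: (z + L i) p0 q1 q2 => p p0 q1 q2.
  rewrite sqrrN.
  by field; rewrite r0 p0 q1 q2.
apply: (eq_hassum e); apply: lattice_telescope => //.
apply: (eq_summable (f := fun i => F (i, j) + F (i, - j))) => [i|]; first by rewrite e.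
have inj (k : I) : injective (fun i : I => (i, k)) by move=> x y [].
exact: summableD (rsummable_inj (inj j) F_summable) (rsummable_inj (inj (- j)) F_summable).
Qed.

(* Sum F over rows, then over columns paired with their opposites. *)
Lemma eis5E : eis 5 z = wp z * eis 3 z.
Proof.
have hS := summableP F_summable; set S := tsum F in hS.
have e1 : S = wp z * eis 3 z.
  apply: (hassum_unique (f := fun i => wp z * (z + L i) ^- 3)).
    apply: (hassum_fubini hS) => i; rewrite mulrC.
    rewrite -(wp_period ab z i).
    by have := hassumZ ((z + L i) ^- 3) (wpP ab (z + L i)).
  by apply: hassumZ; apply: eisP.
rewrite -e1.
pose sw (k : I * I) := (k.2, k.1).
have swK : cancel sw sw by case.
have hS' := hassum_bij swK swK hS.
pose H j := tsum (fun i => F (i, j)).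
have hH j : hassum (fun i => F (i, j)) (H j).
  apply: summableP.
  have inj : injective (fun i : I => (i, j)) by move=> x y [].
  exact: rsummable_inj inj F_summable.
have hHS : hassum H S by apply: (hassum_fubini hS') => j; exact: hH.
have hHS2 := hassumD hHS (hassum_bij (@opprK I) (@opprK I) hHS).
(* The column j = 0 is its own opposite, and there [F (i, 0)] is (z + L i)^-5 since [L 0 ^- 2] = 0;
   all other pairs of columns contribute 0. *)
have h2 : hassum (fun j : I => if j == 0 then 2 * eis 5 z else 0) (S + S).
  apply: eq_hassum hHS2 => j /=; case: eqVneq => [->|j0].
    suff e0 : H 0 = eis 5 z by rewrite oppr0 e0 mulr_natl mulr2n.
    apply: hassum_tsum; apply: eq_hassum (eisP ab z (isT : (2 < 5)%N)) => i.
    by rewrite /F /= lat0 addr0 expr0n invr0 subr0 -invfM -exprD.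
  exact: hassum_unique (hassumD (hH j) (hH (- j))) (F_pair j0).
have h := hassum_unique h2 (hassum_single 0 (2 * eis 5 z)).
have n2 : (2 : C) != 0 by rewrite pnatr_eq0.
by apply: (mulfI n2); rewrite -h mulr_natl mulr2n.
Qed.

End Product.
End Eisenstein.

(** * Local expansions and derivatives *)

Section BigO.
Variable R : realType.
Local Notation C := R[i].
Implicit Types f g p q : C -> C.

(** The point h = 0 is excluded because values there are conventions: [h ^+ 3 * eis 3 h] is 0 at h =
    0, whereas it tends to 1. *)
Definition bigO0 (n : nat) f : Prop :=
  exists2 d : R, 0 < d & exists2 c : R, 0 <= c &
    forall h : C, h != 0 -> cnorm h <= d -> cnorm (f h) <= c * cnorm h ^+ n.

Lemma bigO0_eq n f g : (forall h, h != 0 -> f h = g h) -> bigO0 n f -> bigO0 n g.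
Proof.
move=> e [d d0 [c c0 h]]; exists d => //; exists c => // u u0 ud.
by rewrite -e // h.
Qed.

Lemma bigO0D n f g : bigO0 n f -> bigO0 n g -> bigO0 n (fun h => f h + g h).
Proof.
move=> [d d0 [c c0 hf]] [d' d0' [c' c0' hg]].
exists (Num.min d d'); first by rewrite lt_min d0.
exists (c + c') => [|h h0]; first exact: addr_ge0.
rewrite le_min => /andP[/(hf _ h0) a1 /(hg _ h0) a2].
have := cnormD (f h) (g h); lra.
Qed.

Lemma bigO0M n m f g : bigO0 n f -> bigO0 m g -> bigO0 (n + m) (fun h => f h * g h).
Proof.
move=> [d d0 [c c0 hf]] [d' d0' [c' c0' hg]].
exists (Num.min d d'); first by rewrite lt_min d0.
exists (c * c') => [|h h0]; first exact: mulr_ge0.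
rewrite le_min => /andP[/(hf _ h0) a1 /(hg _ h0) a2].
rewrite cnormM exprD mulrACA ler_pM ?cnorm_ge0 //.
Qed.

Lemma bigO0Z n x f : bigO0 n f -> bigO0 n (fun h => x * f h).
Proof.
move=> [d d0 [c c0 hf]]; exists d => //; exists (cnorm x * c).
  by rewrite mulr_ge0 ?cnorm_ge0.
by move=> h h0 /(hf _ h0) a1; rewrite cnormM -mulrA ler_wpM2l ?cnorm_ge0.
Qed.

Lemma bigO0N n f : bigO0 n f -> bigO0 n (fun h => - f h).
Proof. by move=> /(bigO0Z (-1)); apply: bigO0_eq => h _; rewrite mulN1r. Qed.

Lemma bigO0W n m f : (n <= m)%N -> bigO0 m f -> bigO0 n f.
Proof.
move=> nm [d d0 [c c0 hf]]; exists (Num.min d 1); first by rewrite lt_min d0 ltr01.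
exists c => // h h0; rewrite le_min => /andP[/(hf _ h0) le1 h1].
apply: (le_trans le1); rewrite ler_wpM2l //.
by rewrite ler_wiXn2l ?cnorm_ge0.
Qed.

Lemma bigO0_mono n x : bigO0 n (fun h => x * h ^+ n).
Proof.
apply: bigO0Z; exists 1 => //; exists 1 => // h _ _.
by rewrite cnormX mul1r.
Qed.

Lemma bigO0_cst x : bigO0 0 (fun=> x).
Proof. by apply: bigO0_eq (bigO0_mono 0 x) => h _; rewrite expr0 mulr1. Qed.

Lemma bigO0_mono_eq0 n x : bigO0 n.+1 (fun h => x * h ^+ n) -> x = 0.
Proof.
move=> [d d0 [c c0 h]]; apply: cnorm_lt_eps => e e0.
pose r := Num.min d (e / (c + 1)).
have r0 : 0 < r by rewrite lt_min d0 divr_gt0 //; lra.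
have nr : cnorm (r%:C : C) = r by rewrite cnormR gtr0_norm.
have nz : r%:C != 0 :> C by rewrite -cnorm_gt0 nr.
have := h _ nz; rewrite nr ge_min lexx => /(_ isT).
rewrite cnormM cnormX nr exprS mulrA ler_pM2r ?exprn_gt0 // => /le_trans; apply.
have : r <= e / (c + 1) by rewrite ge_min lexx orbT.
rewrite ler_pdivlMr; last lra.
by nra.
Qed.

Definition eqO (n : nat) f g : Prop := bigO0 n (fun h => f h - g h).

Lemma eqO_sym n f g : eqO n f g -> eqO n g f.
Proof. by move=> /bigO0N; apply: bigO0_eq => h _; rewrite opprB. Qed.

Lemma eqO_trans n f g p : eqO n f g -> eqO n g p -> eqO n f p.
Proof.
by move=> h1 h2; apply: bigO0_eq (bigO0D h1 h2) => h _; rewrite addrA subrK.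
Qed.

Lemma eqOD n f g p q : eqO n f p -> eqO n g q ->
  eqO n (fun h => f h + g h) (fun h => p h + q h).
Proof.
by move=> h1 h2; apply: bigO0_eq (bigO0D h1 h2) => h _; ring.
Qed.

Lemma eqOZ n x f p : eqO n f p -> eqO n (fun h => x * f h) (fun h => x * p h).
Proof. by move=> /(bigO0Z x); apply: bigO0_eq => h _; ring. Qed.

Lemma eqO_bounded n f p : bigO0 0 p -> eqO n f p -> bigO0 0 f.
Proof.
move=> hp /(bigO0W (leq0n n)) h; apply: bigO0_eq (bigO0D h hp) => u _.
by rewrite subrK.
Qed.

Lemma eqOM n f g p q : bigO0 0 p -> bigO0 0 q -> eqO n f p -> eqO n g q ->
  eqO n (fun h => f h * g h) (fun h => p h * q h).
Proof.
move=> hp hq h1 h2; have hf := eqO_bounded hp h1.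
have a1 := bigO0M hf h2; rewrite add0n in a1.
have a2 := bigO0M hq h1; rewrite add0n in a2.
by apply: bigO0_eq (bigO0D a1 a2) => h _; ring.
Qed.

End BigO.

(** * Complex derivatives and functions with zero derivative on a segment *)

Section Derivative.
Local Open Scope classical_set_scope.
Local Open Scope ring_scope.
Variable R : realType.
Local Notation C := R[i].
Implicit Types f g : C -> C.

(** A quadratic remainder, stronger than differentiability; [lat_expansion] provides it with M =
    2. *)
Definition has_der f (z l : C) : Prop := bigO0 2 (fun h => f (z + h) - f z - l * h).

Lemma has_der_cst c z : has_der (fun=> c) z 0.
Proof.
apply: (bigO0_eq (f := fun=> 0)) => [h _|]; first by ring.
by exists 1 => //; exists 0 => // h _ _; rewrite cnorm0 mul0r.
Qed.

Lemma has_derD f g z l m : has_der f z l -> has_der g z m ->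
  has_der (fun z => f z + g z) z (l + m).
Proof. by move=> h1 h2; apply: bigO0_eq (bigO0D h1 h2) => h _; ring. Qed.

Lemma has_derZ x f z l : has_der f z l -> has_der (fun z => x * f z) z (x * l).
Proof. by move=> /(bigO0Z x); apply: bigO0_eq => h _; ring. Qed.

Lemma has_derM f g z l m : has_der f z l -> has_der g z m ->
  has_der (fun z => f z * g z) z (l * g z + f z * m).
Proof.
move=> hf hg.
have lin (x : C) : bigO0 1 (fun h => x * h).
  by apply: bigO0_eq (bigO0_mono 1 x) => h _; rewrite expr1.
have f1 : bigO0 1 (fun h => f (z + h) - f z).
  by apply: bigO0_eq (bigO0D (bigO0W (isT : 1 <= 2)%N hf) (lin l)) => h _; ring.
have g1 : bigO0 1 (fun h => g (z + h) - g z).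
  by apply: bigO0_eq (bigO0D (bigO0W (isT : 1 <= 2)%N hg) (lin m)) => h _; ring.
apply: bigO0_eq (bigO0D (bigO0M f1 g1) (bigO0D (bigO0Z (g z) hf) (bigO0Z (f z) hg))).
by move=> h _; ring.
Qed.

Lemma has_der_unique f g z l m (d : R) : 0 < d ->
  (forall h, cnorm h <= d -> f (z + h) = g (z + h)) ->
  has_der f z l -> has_der g z m -> l = m.
Proof.
move=> d0 e hf hg; apply/eqP; rewrite -subr_eq0; apply/eqP.
apply: (@bigO0_mono_eq0 _ 1).
have [d1 d10 [c c0 h1]] := bigO0D (bigO0N hf) hg.
exists (Num.min d d1); first by rewrite lt_min d0.
exists c => // h h0; rewrite le_min => /andP[/e eh /(h1 _ h0)].
have := e 0; rewrite cnorm0 addr0 => /(_ (ltW d0)) e0.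
rewrite eh e0.
by congr (cnorm _ <= _); ring.
Qed.

Lemma is_derive_quadratic (g : R -> R) (s d c : R) : 0 < d -> 0 <= c ->
  (forall h, `|h| <= d -> `|g (s + h) - g s| <= c * h ^+ 2) -> is_derive s 1 g 0.
Proof.
move=> d0 c0 hg.
suff cv : (fun h : R => h^-1 *: (g (h *: (1 : R) + s) - g s)) @ 0^' --> (0 : R).
  by apply: DeriveDef; [apply/cvg_ex; exists 0|apply: cvg_lim].
apply/cvgrPdist_le => e e0; near=> h.
have h0 : h != 0 by near: h; exact: nbhs_dnbhs_neq.
have hd : `|h| <= Num.min d (e / (c + 1)).
  by near: h; apply: dnbhs0_le; rewrite lt_min d0 divr_gt0 //; lra.
move: hd; rewrite le_min => /andP[/hg le1 le2].
have n0 : 0 < `|h| by rewrite normr_gt0.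
rewrite sub0r normrN normrZ normfV [h *: 1]mulr1 (addrC h) mulrC ler_pdivrMr //.
apply: (le_trans le1); rewrite -[h ^+ 2]ger0_norm ?sqr_ge0 // normrX expr2 mulrA.
rewrite ler_pM2r //; move: le2; rewrite ler_pdivlMr; last lra.
by nra.
Unshelve. all: by end_near.
Qed.

(* Mean value theorem for the real and imaginary parts of s |-> f (s t). *)
Lemma has_der0_segment f (t : C) : t != 0 ->
  (forall s : R, 0 < s -> s <= 1 -> has_der f (s%:C * t) 0) ->
  bigO0 1 f -> f t = 0.
Proof.
move=> t0 hd [d0 d0_gt0 [c0 c0_ge0 h0]].
have nt : 0 < cnorm t by rewrite cnorm_gt0.
(* [phi] will be the real or the imaginary part. The mean value theorem is used on [s0, 1] only, as
   f(0) is a conventional value; the bound near 0 then makes f(s0 t) arbitrarily small. *)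
have cst (phi : C -> R) (s0 : R) : (forall z w, phi (z - w) = phi z - phi w) ->
    (forall z, `|phi z| <= cnorm z) -> 0 < s0 -> s0 < 1 ->
    phi (f t) = phi (f (s0%:C * t)).
  move=> phiB phile s00 s01; pose g s := phi (f (s%:C * t)).
  have dg (s : R) : 0 < s -> s <= 1 -> is_derive s 1 g 0.
    move=> s_gt0 s1; have [d d_gt0 [c c_ge0 h]] := hd s s_gt0 s1.
    apply: (@is_derive_quadratic g s (d / cnorm t) (c * cnorm t ^+ 2)).
    - by rewrite divr_gt0.
    - by rewrite mulr_ge0 ?exprn_ge0 ?cnorm_ge0.
    move=> u; rewrite ler_pdivlMr // => hu; rewrite /g -phiB.
    apply: (le_trans (phile _)).
    have [->|u0] := eqVneq u 0.
      by rewrite addr0 subrr cnorm0 expr0n mulr0.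
    have nz : u%:C * t != 0 by rewrite mulf_neq0 // eq_complex /= negb_and u0.
    have := h _ nz; rewrite cnormM cnormR => /(_ hu).
    rewrite mul0r subr0 -mulrDl -rmorphD exprMn real_normK ?num_real //.
    by rewrite (mulrC (u ^+ 2)) mulrA.
  have [c _] : exists2 c, c \in `]s0, 1[ & g 1 - g s0 = 0 * (1 - s0).
    apply: (@MVT _ g (fun=> 0)) => // [x|].
      by rewrite in_itv /= => /andP[xs0 x1]; apply: dg; lra.
    apply: derivable_within_continuous => x.
    by rewrite in_itv /= => /andP[xs0 x1]; have [] := dg x ltac:(lra) ltac:(lra).
  by rewrite mul0r /g mul1r => /eqP; rewrite subr_eq0 => /eqP.
apply: cnorm_lt_eps => e e0.
pose s0 := Num.min (1 / 2) (Num.min (d0 / cnorm t) (e / (c0 * cnorm t + 1))).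
have p1 : 0 <= c0 * cnorm t by rewrite mulr_ge0 // ltW.
have s00 : 0 < s0.
  by rewrite !lt_min !divr_gt0 //; lra.
have s0d : s0 * cnorm t <= d0 by rewrite -ler_pdivlMr // !ge_min lexx orbT.
have s0e : s0 * (c0 * cnorm t + 1) <= e.
  by rewrite -ler_pdivlMr; [rewrite !ge_min lexx !orbT | lra].
have s01 : s0 <= 1 / 2 by rewrite ge_min lexx.
have eRe := @cst (@complex.Re R) s0 ltac:(by case=> ? ? [? ?]) (@Re_le_cnorm R) s00 ltac:(lra).
have eIm := @cst (@complex.Im R) s0 ltac:(by case=> ? ? [? ?]) (@Im_le_cnorm R) s00 ltac:(lra).
have -> : f t = f (s0%:C * t).
  by move: eRe eIm; case: (f t) => ? ?; case: (f _) => ? ? /= -> ->.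
have nz : s0%:C * t != 0 by rewrite mulf_neq0 // eq_complex /= gt_eqF.
have := h0 _ nz; rewrite cnormM cnormR gtr0_norm // => /(_ s0d) /le_trans; apply.
by rewrite expr1; nra.
Qed.

End Derivative.

Section NearZero.
Variable R : realType.
Local Notation C := R[i].
Local Notation I := (int * int)%type.
Variables a b : C.
Hypothesis ab : b / a \isn't Num.real.
Local Notation L := (lat a b).
Local Notation eis := (eis a b).
Local Notation wp := (wp a b).
Local Notation G k := (eis k 0).

Lemma lat_eq0 i : (0 + L i == 0) = (i == 0).
Proof.
rewrite add0r; apply/eqP/eqP => [e|->]; last exact: lat0.
by apply: (lat_inj ab); rewrite lat0.
Qed.

Lemma eis_expansion k M : (2 < k)%N -> (0 < M)%N ->
  eqO (k + M) (fun h => h ^+ k * eis k h)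
    (fun h => 1 + \sum_(m < M) tcoef R k m * G (k + m) * h ^+ (k + m)).
Proof.
move=> k3 M0.
have [d d0 [c c0 hc]] := lat_expansion ab 0 (ltnW k3) M0 (leq_trans k3 (leq_addr M k)).
exists d => //; exists c => // h h0 /hc[V hV].
have eV : eis k h = h ^- k + G k + V.
  apply: hassum_tsum.
  have := hassumD (hassumD (hassum_single 0 (h ^- k)) (eisP ab 0 k3)) hV.
  apply: eq_hassum => i; rewrite lat_eq0; case: eqVneq => [->|ne].
    by rewrite lat0 !addr0 expr0n gtn_eqF ?invr0 ?addr0 ?(ltn_trans _ k3).
  by rewrite add0r addrC subrK add0r addrC.
move=> hle; set S := \sum_(m < M.-1) _ in hle.
have -> : h ^+ k * eis k h - (1 + \sum_(m < M) tcoef R k m * G (k + m) * h ^+ (k + m)) =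
  h ^+ k * (V - S).
  have rec (F : nat -> C) : \sum_(m < M) F m = F 0 + \sum_(m < M.-1) F m.+1.
    by case: (M) M0 => // M' _; rewrite big_ord_recl.
  rewrite eV (rec (fun m => tcoef R k m * G (k + m) * h ^+ (k + m))) tcoef0 addn0.
  rewrite mul1r mulrBr /S mulr_sumr !mulrDr divff ?expf_neq0 //.
  have -> : \sum_(m < M.-1) tcoef R k m.+1 * G (k + m.+1) * h ^+ (k + m.+1)
    = \sum_(m < M.-1) h ^+ k * (tcoef R k m.+1 * (G (k + m.+1) * h ^+ m.+1)).
    by apply: eq_bigr => m _; rewrite exprD; ring.
  by ring.
by rewrite cnormM cnormX exprD mulrCA ler_wpM2l ?exprn_ge0 ?cnorm_ge0.
Qed.

Lemma wp_expansion M : (0 < M)%N ->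
  eqO (2 + M) (fun h => h ^+ 2 * wp h)
    (fun h => 1 + \sum_(m < M.-1) tcoef R 2 m.+1 * G (2 + m.+1) * h ^+ (2 + m.+1)).
Proof.
move=> M0.
have [d d0 [c c0 hc]] := lat_expansion ab 0 (isT : 1 < 2)%N M0 (leq_add (leqnn 2) M0).
exists d => //; exists c => // h h0 /hc[V hV].
have eV : wp h = h ^- 2 + V.
  apply: hassum_tsum.
  have := hassumD (hassum_single 0 (h ^- 2)) hV.
  apply: eq_hassum => i; rewrite lat_eq0; case: eqVneq => [->|ne].
    by rewrite lat0 !addr0 expr0n invr0 subr0.
  by rewrite !add0r (addrC h).
move=> hle; set S := \sum_(m < M.-1) _ in hle.
have -> : h ^+ 2 * wp h - (1 + \sum_(m < M.-1) tcoef R 2 m.+1 * G (2 + m.+1) * h ^+ (2 + m.+1)) =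
  h ^+ 2 * (V - S).
  rewrite eV mulrDr divff ?expf_neq0 // mulrBr /S mulr_sumr.
  have -> : \sum_(m < M.-1) tcoef R 2 m.+1 * G (2 + m.+1) * h ^+ (2 + m.+1)
    = \sum_(m < M.-1) h ^+ 2 * (tcoef R 2 m.+1 * (G (2 + m.+1) * h ^+ m.+1)).
    by apply: eq_bigr => i _; rewrite exprD; ring.
  by ring.
by rewrite cnormM cnormX exprD mulrCA ler_wpM2l ?exprn_ge0 ?cnorm_ge0.
Qed.

Lemma eis0_odd k : (2 < k)%N -> odd k -> G k = 0.
Proof.
move=> k3 ok; have := eisN ab 0 k3; rewrite oppr0 -signr_odd ok expr1 mulN1r => e.
have n2 : (2 : C) != 0 by rewrite pnatr_eq0.
by apply: (mulfI n2); rewrite mulr0 mulr_natl mulr2n {1}e addNr.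
Qed.

Lemma near0_off_lattice : exists2 d : R, 0 < d &
  forall h : C, h != 0 -> cnorm h <= d -> forall i, h + L i != 0.
Proof.
have [d d0 hd] := lat_gap ab 0.
exists (d / 2) => [|h h0 hh i]; first lra.
have [->|i0] := eqVneq i 0; first by rewrite lat0 addr0.
have := hd i; rewrite lat_eq0 => /(_ i0); rewrite add0r => hi.
rewrite -cnorm_gt0; have := cnormB (h + L i) h; rewrite addrAC subrr add0r; lra.
Qed.

Lemma eis5E_near0 n : eqO n (fun h => h ^+ 5 * eis 5 h)
  (fun h => (h ^+ 2 * wp h) * (h ^+ 3 * eis 3 h)).
Proof.
have [d d0 hd] := near0_off_lattice.
exists d => //; exists 0 => // h h0 hh.
rewrite (eis5E ab (hd h h0 hh)) (_ : _ - _ = 0) ?cnorm0 ?mul0r //; ring.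
Qed.

End NearZero.

(** * Differential equations *)

Section Bounded.
Variable R : realType.
Local Notation C := R[i].

Lemma bigO0M0 (f g : C -> C) : bigO0 0 f -> bigO0 0 g -> bigO0 0 (fun h => f h * g h).
Proof. exact: (@bigO0M R 0 0). Qed.

Lemma bigO0X0 n : bigO0 0 (fun h : C => h ^+ n).
Proof.
by apply: (bigO0W (leq0n n)); apply: bigO0_eq (bigO0_mono n 1) => h _; rewrite mul1r.
Qed.

Lemma bigO0_factor n m (f g : C -> C) : (n <= m)%N ->
  (forall h, f h = h ^+ m * g h) -> bigO0 0 g -> bigO0 n f.
Proof.
move=> nm e hg; apply: (bigO0W nm); apply: (bigO0_eq (f := fun h => (1 * h ^+ m) * g h)).
  by move=> h _; rewrite mul1r e.
by have := bigO0M (bigO0_mono m 1) hg; rewrite addn0.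
Qed.

Lemma bigO0_div n m (f : C -> C) : bigO0 (n + m) (fun h => h ^+ n * f h) -> bigO0 m f.
Proof.
move=> [d d0 [c c0 hf]]; exists d => //; exists c => // h h0 /(hf _ h0).
rewrite cnormM cnormX exprD mulrCA ler_pM2l //.
by rewrite exprn_gt0 // cnorm_gt0.
Qed.

Lemma eqO_bigO n (f g : C -> C) : eqO n f g -> bigO0 n g -> bigO0 n f.
Proof.
by move=> h1 h2; apply: bigO0_eq (bigO0D h1 h2) => h _; rewrite subrK.
Qed.

Lemma eqOW n m (f g : C -> C) : (n <= m)%N -> eqO m f g -> eqO n f g.
Proof. exact: bigO0W. Qed.

Lemma eqO_refl n (f : C -> C) : eqO n f f.
Proof.
exists 1 => //; exists 0 => // h _ _.
by rewrite subrr cnorm0 mul0r.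
Qed.

End Bounded.

Ltac bounded := lazymatch goal with
  | |- bigO0 0 (fun h => (@?f h) + (@?g h)) => apply: (@bigO0D _ 0 f g); bounded
  | |- bigO0 0 (fun h => - (@?f h)) => apply: (@bigO0N _ 0 f); bounded
  | |- bigO0 0 (fun h => (@?f h) * (@?g h)) => apply: (@bigO0M0 _ f g); bounded
  | |- bigO0 0 (fun h => h ^+ ?n) => exact: (@bigO0X0 _ n)
  | |- bigO0 0 (fun h => ?x) => exact: bigO0_cst
  end.

Section Relations.
Variable R : realType.
Local Notation C := R[i].
Local Notation I := (int * int)%type.
Variables a b : C.
Hypothesis ab : b / a \isn't Num.real.
Local Notation L := (lat a b).
Local Notation eis := (eis a b).
Local Notation wp := (wp a b).
Local Notation G k := (eis k 0).

Lemma tcoefE k m c : 'C((k + m).-1, m) = c -> tcoef R k m = (-1) ^+ m * c%:R.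
Proof. by move=> <-. Qed.

Lemma wp_expansion9 : eqO 9 (fun h => h ^+ 2 * wp h)
  (fun h => 1 + 3 * G 4 * h ^+ 4 + 5 * G 6 * h ^+ 6 + 7 * G 8 * h ^+ 8).
Proof.
have := wp_expansion ab (isT : 0 < 7)%N; apply: bigO0_eq => h _; congr (_ - _).
rewrite !big_ord_recl big_ord0 /= /bump /= !(addSn, add0n).
rewrite (@eis0_odd _ _ _ ab 3) // (@eis0_odd _ _ _ ab 5) // (@eis0_odd _ _ _ ab 7) //.
rewrite (@tcoefE 2 2 3) // (@tcoefE 2 4 5) // (@tcoefE 2 6 7) //.
ring.
Qed.

Lemma eis3_expansion9 : eqO 9 (fun h => h ^+ 3 * eis 3 h)
  (fun h => 1 - 3 * G 4 * h ^+ 4 - 10 * G 6 * h ^+ 6 - 21 * G 8 * h ^+ 8).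
Proof.
have := eis_expansion ab (isT : 2 < 3)%N (isT : 0 < 6)%N.
apply: bigO0_eq => h _; congr (_ - _).
rewrite !big_ord_recl big_ord0 /= /bump /= !(addSn, add0n, addn0).
rewrite (@eis0_odd _ _ _ ab 3) // (@eis0_odd _ _ _ ab 5) // (@eis0_odd _ _ _ ab 7) //.
rewrite (@tcoefE 3 1 3) // (@tcoefE 3 3 10) // (@tcoefE 3 5 21) //.
ring.
Qed.

Lemma eis4_expansion9 : eqO 9 (fun h => h ^+ 4 * eis 4 h)
  (fun h => 1 + G 4 * h ^+ 4 + 10 * G 6 * h ^+ 6 + 35 * G 8 * h ^+ 8).
Proof.
have := eis_expansion ab (isT : 2 < 4)%N (isT : 0 < 5)%N.
apply: bigO0_eq => h _; congr (_ - _).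
rewrite !big_ord_recl big_ord0 /= /bump /= !(addSn, add0n, addn0).
rewrite (@eis0_odd _ _ _ ab 5) // (@eis0_odd _ _ _ ab 7) //.
rewrite tcoef0 (@tcoefE 4 2 10) // (@tcoefE 4 4 35) //.
ring.
Qed.

Lemma eis5_expansion9 : eqO 9 (fun h => h ^+ 5 * eis 5 h)
  (fun h => 1 - 5 * G 6 * h ^+ 6 - 35 * G 8 * h ^+ 8).
Proof.
have := eis_expansion ab (isT : 2 < 5)%N (isT : 0 < 4)%N.
apply: bigO0_eq => h _; congr (_ - _).
rewrite !big_ord_recl big_ord0 /= /bump /= !(addSn, add0n, addn0).
rewrite (@eis0_odd _ _ _ ab 5) // (@eis0_odd _ _ _ ab 7) //.
rewrite (@tcoefE 5 1 5) // (@tcoefE 5 3 35) //.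
ring.
Qed.

(** Degree 8 in E_5 = P E_3 reads -35 G_8 = 7 G_8 - 21 G_8 - 9 G_4^2; the degrees below match
    identically. *)
Lemma G8E : 7 * G 8 = 3 * G 4 ^+ 2.
Proof.
have h1 : eqO 9 (fun h => h ^+ 5 * eis 5 h)
    (fun h => (1 + 3 * G 4 * h ^+ 4 + 5 * G 6 * h ^+ 6 + 7 * G 8 * h ^+ 8) *
              (1 - 3 * G 4 * h ^+ 4 - 10 * G 6 * h ^+ 6 - 21 * G 8 * h ^+ 8)).
  apply: eqO_trans (eis5E_near0 ab 9) _.
  by apply: eqOM; [bounded | bounded | exact: wp_expansion9 | exact: eis3_expansion9].
have h2 := eqO_trans (eqO_sym eis5_expansion9) h1.
have h3 : bigO0 9 (fun h => (9 * G 4 ^+ 2 - 21 * G 8) * h ^+ 8).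
  have hb : bigO0 9 (fun h : C => h ^+ 9 * (
       (3 * G 4 * 10 * G 6 + 5 * G 6 * 3 * G 4) * h ^+ 1
       + (3 * G 4 * 21 * G 8 + 5 * G 6 * 10 * G 6 + 7 * G 8 * 3 * G 4) * h ^+ 3
       + (5 * G 6 * 21 * G 8 + 7 * G 8 * 10 * G 6) * h ^+ 5
       + (7 * G 8 * 21 * G 8) * h ^+ 7)).
    by apply: bigO0_factor (leqnn 9) _ _ => [h|]; [reflexivity | bounded].
  apply: bigO0_eq (bigO0D h2 (bigO0N hb)) => h _; ring.
have := bigO0_mono_eq0 h3 => e.
have n3 : (3 : C) != 0 by rewrite pnatr_eq0.
apply: (mulfI n3).
have -> : 3 * (7 * G 8) = 3 * (3 * G 4 ^+ 2) - (9 * G 4 ^+ 2 - 21 * G 8) by ring.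
by rewrite e subr0.
Qed.

Lemma off_lattice_open z : (forall i, z + L i != 0) ->
  exists2 d : R, 0 < d & forall h : C, cnorm h <= d -> forall i, z + h + L i != 0.
Proof.
move=> zL; have [d d0 hd] := lat_gap ab z.
exists (d / 2) => [|h hh i]; first lra.
rewrite -cnorm_gt0; have := cnormB (z + h + L i) h.
have -> : z + h + L i - h = z + L i by ring.
have := hd i (zL i); lra.
Qed.

Lemma eis_der k z : (2 < k)%N -> (forall i, z + L i != 0) ->
  has_der (eis k) z (- k%:R * eis k.+1 z).
Proof.
move=> k3 zL.
have [d d0 [c c0 hc]] := lat_expansion ab z (ltnW k3) (isT : 0 < 2)%N (leq_trans k3 (leq_addr 2 k)).
exists d => //; exists c => // h h0 /hc[V hV].
have -> : V = eis k (z + h) - eis k z.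
  apply: (hassum_unique hV); apply: eq_hassum (hassumB (eisP ab (z + h) k3) (eisP ab z k3)) => i.
  by rewrite (negPf (zL i)) (addrAC z).
rewrite big_ord1 (@tcoefE k 1 k); last by rewrite addn1 bin1.
by rewrite addn1 !expr1 mulN1r mulrA.
Qed.

Lemma wp_der z : (forall i, z + L i != 0) -> has_der wp z (- 2 * eis 3 z).
Proof.
move=> zL.
have [d d0 [c c0 hc]] := lat_expansion ab z (isT : 1 < 2)%N (isT : 0 < 2)%N (isT : 2 < 4)%N.
exists d => //; exists c => // h h0 /hc[V hV].
have -> : V = wp (z + h) - wp z.
  apply: (hassum_unique hV); apply: eq_hassum (hassumB (wpP ab (z + h)) (wpP ab z)) => i.
  by rewrite (negPf (zL i)) (addrAC z) opprB addrA subrK.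
rewrite big_ord1 (@tcoefE 2 1 2) //.
by rewrite !expr1 mulN1r mulrA.
Qed.

Lemma der_relation (f g : C -> C) z l m :
  (forall z, (forall i, z + L i != 0) -> f z = g z) -> (forall i, z + L i != 0) ->
  has_der f z l -> has_der g z m -> l = m.
Proof.
move=> e zL; have [d d0 hd] := off_lattice_open zL.
by apply: (has_der_unique d0) => h /hd; exact: e.
Qed.

(** Derivative of [eis5E], with P' = -2 E_3 and E_k' = -k E_(k+1). Two more derivatives give [eis7E]
    and [eis8E], the last being needed to express G_8 of the overlattice. *)
Lemma eis6E z : (forall i, z + L i != 0) ->
  5 * eis 6 z = 2 * (eis 3 z * eis 3 z) + 3 * (wp z * eis 4 z).
Proof.
move=> zL; have := der_relation (eis5E ab) zL (eis_der (isT : 2 < 5)%N zL)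
  (has_derM (wp_der zL) (eis_der (isT : 2 < 3)%N zL)).
by move=> h; apply: oppr_inj; move: h; rewrite mulNr => ->; ring.
Qed.

Lemma eis7E z : (forall i, z + L i != 0) ->
  5 * eis 7 z = 3 * (eis 3 z * eis 4 z) + 2 * (wp z * eis 5 z).
Proof.
move=> zL; have := der_relation eis6E zL (has_derZ 5 (eis_der (isT : 2 < 6)%N zL))
  (has_derD (has_derZ 2 (has_derM (eis_der (isT : 2 < 3)%N zL) (eis_der (isT : 2 < 3)%N zL)))
    (has_derZ 3 (has_derM (wp_der zL) (eis_der (isT : 2 < 4)%N zL)))).
move=> h; have n6 : (- 6 : C) != 0 by rewrite oppr_eq0 pnatr_eq0.
apply: (mulfI n6); move: h; rewrite mulrCA => ->; ring.
Qed.

Lemma eis8E z : (forall i, z + L i != 0) ->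
  35 * eis 8 z = 9 * (eis 4 z * eis 4 z) + 16 * (eis 3 z * eis 5 z)
                 + 10 * (wp z * eis 6 z).
Proof.
move=> zL; have := der_relation eis7E zL (has_derZ 5 (eis_der (isT : 2 < 7)%N zL))
  (has_derD (has_derZ 3 (has_derM (eis_der (isT : 2 < 3)%N zL) (eis_der (isT : 2 < 4)%N zL)))
    (has_derZ 2 (has_derM (wp_der zL) (eis_der (isT : 2 < 5)%N zL)))).
move=> h; apply: oppr_inj.
have -> : - (35 * eis 8 z) = 5 * (- 7 * eis 8 z) by ring.
rewrite h; ring.
Qed.

Section Segment.
Variable t : C.
Hypothesis tL : forall s : R, 0 < s -> s <= 1 -> forall i, s%:C * t + L i != 0.

Let t1L i : t + L i != 0.
Proof. by have := tL ltr01 (lexx 1) i; rewrite mul1r. Qed.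

Let t_neq0 : t != 0.
Proof. by have := t1L 0; rewrite lat0 addr0. Qed.

(* For z off the lattice the derivative of E_4 - P^2 is -4 (E_5 - P E_3) = 0. *)
Lemma eis4E : eis 4 t = wp t * wp t - 5 * G 4.
Proof.
pose X z := eis 4 z + ((-1) * (wp z * wp z) + 5 * G 4).
suff : X t = 0.
  move=> e; apply/eqP; rewrite -subr_eq0 -[X in _ == X]e /X; apply/eqP; ring.
apply: has_der0_segment t_neq0 _ _ => [s s0 s1|].
  have zL := tL s0 s1; set z := s%:C * t in zL *.
  have := has_derD (eis_der (isT : 2 < 4)%N zL)
    (has_derD (has_derZ (-1) (has_derM (wp_der zL) (wp_der zL))) (has_der_cst (5 * G 4) z)).
  congr (has_der _ _ _); rewrite (eis5E ab zL); ring.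
apply: (@bigO0_div _ 4).
apply: (bigO0_eq (f := fun h => h ^+ 4 * eis 4 h +
   ((-1) * ((h ^+ 2 * wp h) * (h ^+ 2 * wp h)) + 5 * G 4 * h ^+ 4))).
  by move=> h _; rewrite /X; ring.
have hu := eqOW (isT : 5 <= 9)%N wp_expansion9.
have hv := eqOW (isT : 5 <= 9)%N eis4_expansion9.
apply: (eqO_bigO (eqOD hv (eqOD (eqOZ (-1) (eqOM _ _ hu hu)) (@eqO_refl _ _ (fun h => 5 * G 4 * h ^+ 4))))); try bounded.
(* Degree 0 cancels and degree 4 is G_4 - 6 G_4 + 5 G_4 = 0, which fixes the constant 5 G_4; the
   remainder starts at degree 6. *)
apply: (bigO0_factor (isT : 5 <= 6)%N (g := fun h => (10 * G 6 - 10 * G 6) +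
  (35 * G 8 - 9 * G 4 ^+ 2 - 14 * G 8) * h ^+ 2 - 30 * G 4 * G 6 * h ^+ 4
  - (25 * G 6 ^+ 2 + 42 * G 4 * G 8) * h ^+ 6 - 70 * G 6 * G 8 * h ^+ 8
  - 49 * G 8 ^+ 2 * h ^+ 10)) => [h|]; last by bounded.
by ring.
Qed.

End Segment.

Section Segment.
Variable t : C.
Hypothesis tL : forall s : R, 0 < s -> s <= 1 -> forall i, s%:C * t + L i != 0.

Let tsL (s : R) : 0 < s -> s <= 1 ->
  forall r : R, 0 < r -> r <= 1 -> forall i, r%:C * (s%:C * t) + L i != 0.
Proof.
move=> s0 s1 r r0 r1 i; rewrite mulrA -rmorphM; apply: tL.
  exact: mulr_gt0.
by rewrite -[leRHS]mul1r ler_pM // ltW.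
Qed.

(** Since P' = -2 E_3, this is P'^2 = 4 P^3 - g2 P - g3 with g2 = 60 G_4 and g3 = 140 G_6. The
    derivative of the difference is -6 E_3 (E_4 - P^2 + 5 G_4), zero by [eis4E] at each point of the
    segment. *)
Lemma eis3E : eis 3 t * eis 3 t = wp t * (wp t * wp t) - 15 * G 4 * wp t - 35 * G 6.
Proof.
pose X z := eis 3 z * eis 3 z + ((-1) * (wp z * (wp z * wp z)) + (15 * G 4 * wp z + 35 * G 6)).
have t0 : t != 0 by have := tL ltr01 (lexx 1) 0; rewrite mul1r lat0 addr0.
suff : X t = 0.
  move=> e; apply/eqP; rewrite -subr_eq0 -[X in _ == X]e /X; apply/eqP; ring.
apply: has_der0_segment t0 _ _ => [s s0 s1|].
  have e4 := eis4E (tsL s0 s1).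
  have zL := tL s0 s1; set z := s%:C * t in zL e4 *.
  have h3 := eis_der (isT : 2 < 3)%N zL; have hw := wp_der zL.
  have := has_derD (has_derM h3 h3)
    (has_derD (has_derZ (-1) (has_derM hw (has_derM hw hw)))
              (has_derD (has_derZ (15 * G 4) hw) (has_der_cst (35 * G 6) z))).
  congr (has_der _ _ _); rewrite e4; ring.
apply: (@bigO0_div _ 6).
apply: (bigO0_eq (f := fun h => (h ^+ 3 * eis 3 h) * (h ^+ 3 * eis 3 h) +
   ((-1) * ((h ^+ 2 * wp h) * ((h ^+ 2 * wp h) * (h ^+ 2 * wp h))) +
   ((15 * G 4 * h ^+ 4) * (h ^+ 2 * wp h) + 35 * G 6 * h ^+ 6)))).
  by move=> h _; rewrite /X; ring.
have hu : eqO 7 (fun h => h ^+ 2 * wp h)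
    (fun h => 1 + 3 * G 4 * h ^+ 4 + 5 * G 6 * h ^+ 6).
  apply: bigO0_eq (bigO0D (eqOW (isT : 7 <= 9)%N wp_expansion9)
    (bigO0W (isT : 7 <= 8)%N (bigO0_mono 8 (7 * G 8)))) => h _; ring.
have hv : eqO 7 (fun h => h ^+ 3 * eis 3 h)
    (fun h => 1 - 3 * G 4 * h ^+ 4 - 10 * G 6 * h ^+ 6).
  apply: bigO0_eq (bigO0D (eqOW (isT : 7 <= 9)%N eis3_expansion9)
    (bigO0W (isT : 7 <= 8)%N (bigO0_mono 8 (- 21 * G 8)))) => h _; ring.
apply: (eqO_bigO (eqOD (eqOM _ _ hv hv) (eqOD (eqOZ (-1) (eqOM _ _ hu (eqOM _ _ hu hu)))
  (eqOD (eqOM _ _ (@eqO_refl _ _ (fun h => 15 * G 4 * h ^+ 4)) hu) (@eqO_refl _ _ (fun h => 35 * G 6 * h ^+ 6)))))); try bounded.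
(* The coefficients of G_4 in degree 4 and of G_6 in degree 6 are -6 - 9 + 15 and -20 - 15 + 35,
   both 0; the remainder starts at degree 8. *)
apply: (bigO0_factor (isT : 7 <= 8)%N (g := fun h =>
   (9 * G 4 ^+ 2 - 27 * G 4 ^+ 2 + 45 * G 4 ^+ 2)
   + (60 * G 4 * G 6 - 90 * G 4 * G 6 + 75 * G 4 * G 6) * h ^+ 2
   + (100 * G 6 ^+ 2 - 75 * G 6 ^+ 2 - 27 * G 4 ^+ 3) * h ^+ 4
   - 135 * G 4 ^+ 2 * G 6 * h ^+ 6 - 225 * G 4 * G 6 ^+ 2 * h ^+ 8
   - 125 * G 6 ^+ 3 * h ^+ 10)) => [h|]; last by bounded.
by ring.
Qed.

End Segment.
End Relations.

(** * The invariants determine the lattice *)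

(** Pascal's rule, by an induction that also carries n <= C(n, 3). It keeps the leading coefficient
    of the recursion for G_k away from 0. *)
Lemma bin2_le_bin4 n : (6 < n)%N -> ('C(n, 2) <= 'C(n, 4))%N.
Proof.
suff h m : (m.+3.+4 <= 'C(m.+3.+4, 3))%N /\ ('C(m.+3.+4, 2) <= 'C(m.+3.+4, 4))%N.
  by case: n => [|[|[|[|[|[|[|m]]]]]]] // _; have [] := h m.
elim: m => [//|m [IH3 IH4]]; split.
  rewrite [leqRHS]binS -addn1 leq_add //.
  by rewrite bin_gt0.
by rewrite [leqRHS]binS [leqLHS]binS bin1 leq_add.
Qed.

Section Recursion.
Variable R : realType.
Local Notation C := R[i].
Local Notation I := (int * int)%type.
Variables a b a' b' : C.
Hypothesis ab : b / a \isn't Num.real.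
Hypothesis ab' : b' / a' \isn't Num.real.
Local Notation G k := (eis a b k 0).
Local Notation G' k := (eis a' b' k 0).

Lemma eqO_difference n m e (f f' : C -> C) (x x' : nat -> C) :
  eqO n f (fun h => 1 + \sum_(i < m.+1) x i * h ^+ (e + i)) ->
  eqO n f' (fun h => 1 + \sum_(i < m.+1) x' i * h ^+ (e + i)) ->
  (forall i, (i < m)%N -> x i = x' i) ->
  eqO n (fun h => f h - f' h) (fun h => (x m - x' m) * h ^+ (e + m)).
Proof.
move=> h1 h2 ex; apply: bigO0_eq (bigO0D h1 (bigO0N h2)) => h _.
rewrite !big_ord_recr /= (eq_bigr (fun i : 'I_m => x' i * h ^+ (e + i))) => [|i _].
  ring.
by rewrite ex.
Qed.

(** For even k >= 8, compare E_5 = P E_3 for both lattices in degree k: the products of lower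
    moments agree, and what remains is a coefficient times G_k - G'_k. With n = k - 1 this
    coefficient is C(n,2) - C(n,4) - n; it is 0 for k = 4 and k = 6, which leaves G_4 and G_6 free,
    and negative from k = 8 on. *)
Lemma eis0_determined : G 4 = G' 4 -> G 6 = G' 6 ->
  forall k, (2 < k)%N -> G k = G' k.
Proof.
move=> e4 e6; elim/ltn_ind => k IH k3.
case ok : (odd k); first by rewrite (eis0_odd ab) ?(eis0_odd ab').
have [k4|k6] : (k = 4 \/ k = 6 \/ 8 <= k)%N by move: ok; case: k {IH} k3 => [|[|[|[|[|[|[|[|k]]]]]]]] //; auto.
  by rewrite k4.
case: k6 => [->//|k8].
have [K [kE K3 oK]] : exists K, [/\ k = K.+1.+4, (2 < K)%N & odd K].
  exists (k - 5)%N; split; [lia | lia | rewrite oddB ?ok //; lia].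
subst k; set k := K.+1.+4.
apply/eqP; rewrite -subr_eq0; apply/eqP; set d := G k - G' k.
pose u h := h ^+ 2 * wp a b h; pose u' h := h ^+ 2 * wp a' b' h.
pose v h := h ^+ 3 * eis a b 3 h; pose v' h := h ^+ 3 * eis a' b' 3 h.
have hu : eqO k.+1 (fun h => u h - u' h) (fun h => tcoef R 2 K.+3 * d * h ^+ k).
  have := wp_expansion ab (isT : 0 < K.+4)%N; have := wp_expansion ab' (isT : 0 < K.+4)%N.
  move=> h' h; have := @eqO_difference k.+1 K.+2 3 u u'
    (fun m => tcoef R 2 m.+1 * G m.+3) (fun m => tcoef R 2 m.+1 * G' m.+3) h h'.
  rewrite -mulrBr; apply=> i iK.
  by rewrite IH //; lia.
have hv : eqO k.+1 (fun h => v h - v' h) (fun h => tcoef R 3 K.+2 * d * h ^+ k).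
  have := eis_expansion ab (isT : 2 < 3)%N (isT : 0 < K.+3)%N.
  have := eis_expansion ab' (isT : 2 < 3)%N (isT : 0 < K.+3)%N.
  move=> h' h; have := @eqO_difference k.+1 K.+2 3 v v'
    (fun m => tcoef R 3 m * G m.+3) (fun m => tcoef R 3 m * G' m.+3) h h'.
  rewrite -mulrBr; apply=> i iK.
  by rewrite IH //; lia.
have hw : eqO k.+1 (fun h => h ^+ 5 * eis a b 5 h - h ^+ 5 * eis a' b' 5 h)
    (fun h => tcoef R 5 K * d * h ^+ k).
  have := eis_expansion ab (isT : 2 < 5)%N (isT : 0 < K.+1)%N.
  have := eis_expansion ab' (isT : 2 < 5)%N (isT : 0 < K.+1)%N.
  move=> h' h; have := @eqO_difference k.+1 K 5 _ _
    (fun m => tcoef R 5 m * G m.+1.+4) (fun m => tcoef R 5 m * G' m.+1.+4) h h'.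
  rewrite -mulrBr; apply=> i iK.
  by rewrite IH //; lia.
have v1 : eqO 1 v (fun=> 1).
  apply: (eqO_trans (eqOW (isT : 1 <= 9)%N (eis3_expansion9 ab))).
  apply: (bigO0_factor (isT : 1 <= 4)%N (g := fun h => - 3 * G 4 - 10 * G 6 * h ^+ 2
     - 21 * G 8 * h ^+ 4)) => [h|]; [ring | bounded].
have u1 : eqO 1 u' (fun=> 1).
  apply: (eqO_trans (eqOW (isT : 1 <= 9)%N (wp_expansion9 ab'))).
  apply: (bigO0_factor (isT : 1 <= 4)%N (g := fun h => 3 * G' 4 + 5 * G' 6 * h ^+ 2
     + 7 * G' 8 * h ^+ 4)) => [h|]; [ring | bounded].
have hprod : eqO k.+1 (fun h => u h * v h - u' h * v' h)
    (fun h => (tcoef R 2 K.+3 + tcoef R 3 K.+2) * d * h ^+ k).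
  have bv := eqO_bounded (bigO0_cst 1) v1; have bu := eqO_bounded (bigO0_cst 1) u1.
  (* u v - u' v' = (u - u') v + u' (v - v'), where v and u' may be replaced by 1 at the cost of one
     degree. *)
  have t1 := bigO0M hu bv; rewrite addn0 in t1.
  have t2 := bigO0M bu hv; rewrite add0n in t2.
  have t3 := bigO0M (bigO0_mono k (tcoef R 2 K.+3 * d)) v1; rewrite addn1 in t3.
  have t4 := bigO0M (bigO0_mono k (tcoef R 3 K.+2 * d)) u1; rewrite addn1 in t4.
  by apply: bigO0_eq (bigO0D (bigO0D t1 t2) (bigO0D t3 t4)) => h _; ring.
have hfin : bigO0 k.+1 (fun h => ((tcoef R 5 K - (tcoef R 2 K.+3 + tcoef R 3 K.+2)) * d) * h ^+ k).
  apply: bigO0_eq (bigO0D (bigO0N hw) (bigO0D (bigO0D (eis5E_near0 ab k.+1)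
    (bigO0N (eis5E_near0 ab' k.+1))) hprod)) => h _.
  by rewrite /u /v /u' /v'; ring.
move/eqP: (bigO0_mono_eq0 hfin); rewrite mulf_eq0 => /orP[/eqP coef0|/eqP//].
have := bin2_le_bin4 (n := K.+4) ltac:(lia).
suff : ('C(K.+4, 2) = 'C(K.+4, 4) + K.+4)%N by lia.
apply/eqP; rewrite -(eqr_nat C) natrD -subr_eq0 -[X in _ == X]coef0; apply/eqP.
rewrite (@tcoefE _ 5 K 'C(K.+4, 4)); last by rewrite -(bin_sub (n := K.+4) (m := 4)) ?subSS ?subn0.
rewrite (@tcoefE _ 2 K.+3 K.+4); last by rewrite binSn.
rewrite (@tcoefE _ 3 K.+2 'C(K.+4, 2)); last by rewrite -(bin_sub (n := K.+4) (m := 2)) ?subSS ?subn0.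
rewrite -signr_odd -[(-1) ^+ K.+3]signr_odd -[(-1) ^+ K.+2]signr_odd /= oK /=; ring.
Qed.

End Recursion.

(** * Recovering the lattice points from the moments *)

Section Moments.
Variable R : realType.
Local Notation C := R[i].
Local Notation I := (int * int)%type.

Lemma horner_bound (p : {poly C}) (X : R) : 0 <= X ->
  exists2 B : R, 0 <= B & forall x : C, cnorm x <= X -> cnorm p.[x] <= B.
Proof.
move=> X0; exists (\sum_(i < size p) cnorm p`_i * X ^+ i).
  by apply: sumr_ge0 => i _; rewrite mulr_ge0 ?cnorm_ge0 ?exprn_ge0.
move=> x hx; rewrite horner_coef (le_trans (cnorm_sum _ _)) //.
apply: ler_sum => i _; rewrite cnormM cnormX ler_wpM2l ?cnorm_ge0 //.
by rewrite lerXn2r ?nnegrE ?cnorm_ge0.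
Qed.

(** Outside [s0] the ratio w0/w has modulus at most 1/2: three of its factors secure convergence and
    the other k give 2^-k, while p is bounded on the disc containing all these 1/w. *)
Lemma lat_tail_moments (a b w0 : C) (p : {poly C}) (s0 : seq I) :
  b / a \isn't Num.real -> w0 != 0 ->
  (forall i, i \notin s0 -> 2 * cnorm w0 <= cnorm (lat a b i)) ->
  exists2 B : R, 0 <= B & forall k S,
    hassum (fun i => if i \in s0 then 0 else
              (w0 / lat a b i) ^+ (3 + k) * p.[(lat a b i)^-1]) S ->
    cnorm S <= B / 2 ^+ k.
Proof.
move=> ab w00 hs0.
have r0 : 0 < cnorm w0 by rewrite cnorm_gt0.
have [Q Q0 hQ] := @horner_bound p (2 * cnorm w0)^-1 ltac:(by rewrite invr_ge0; lra).
have [M hM] := lat_summable ab 0 (isT : 2 < 3)%N.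
exists (cnorm w0 ^+ 3 * Q * `|M|) => [|k S hS].
  by rewrite !mulr_ge0 ?exprn_ge0 ?cnorm_ge0.
apply: hassum_norm_le hS => s us.
apply: (le_trans (y := \sum_(i <- s) cnorm w0 ^+ 3 * Q / 2 ^+ k * cnorm ((0 + lat a b i) ^- 3))).
  apply: ler_sum => i _; rewrite add0r.
  have k0 : 0 <= (2 ^+ k : R)^-1 by rewrite invr_ge0 exprn_ge0.
  case: (boolP (i \in s0)) => [_|/hs0 hi].
    by rewrite cnorm0 !mulr_ge0 ?exprn_ge0 ?cnorm_ge0.
  set w := lat a b i in hi *.
  have nw : 0 < cnorm w by lra.
  have -> : cnorm ((w0 / w) ^+ (3 + k) * p.[w^-1]) =
      cnorm w0 ^+ 3 * (cnorm w)^-1 ^+ 3 * (cnorm w0 / cnorm w) ^+ k * cnorm p.[w^-1].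
    by rewrite cnormM cnormX cnormM cnormV exprD [(_ * _) ^+ 3]exprMn.
  have h1 : (cnorm w0 / cnorm w) ^+ k <= (2 ^+ k)^-1.
    rewrite -exprVn lerXn2r ?nnegrE ?invr_ge0 ?divr_ge0 ?cnorm_ge0 //.
    rewrite ler_pdivrMr //; lra.
  have h2 : cnorm p.[w^-1] <= Q.
    by apply: hQ; rewrite cnormV lef_pV2 ?posrE //; lra.
  rewrite cnormV cnormX.
  have -> : cnorm w0 ^+ 3 * Q / 2 ^+ k * (cnorm w ^+ 3)^-1 =
     cnorm w0 ^+ 3 * (cnorm w)^-1 ^+ 3 * (2 ^+ k)^-1 * Q by rewrite exprVn; ring.
  have c0 : 0 <= cnorm w0 ^+ 3 * (cnorm w)^-1 ^+ 3.
    by rewrite mulr_ge0 ?exprn_ge0 ?invr_ge0 ?cnorm_ge0.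
  have q0 : 0 <= (cnorm w0 / cnorm w) ^+ k by rewrite exprn_ge0 ?divr_ge0 ?cnorm_ge0.
  by rewrite ler_pM ?cnorm_ge0 ?(mulr_ge0 c0 q0) // ler_wpM2l.
rewrite -mulr_sumr.
have -> : cnorm w0 ^+ 3 * Q * `|M| / 2 ^+ k = cnorm w0 ^+ 3 * Q / 2 ^+ k * `|M| by ring.
rewrite ler_wpM2l ?(le_trans (hM _ us)) ?ler_norm //.
by rewrite !mulr_ge0 ?invr_ge0 ?exprn_ge0 ?cnorm_ge0.
Qed.

(** Expanding p shows that the weighted moments depend on the lattice only through the G_m with m >=
    3. *)
Lemma lat_moments (a b w0 : C) (p : {poly C}) k : b / a \isn't Num.real ->
  hassum (fun i => (w0 / lat a b i) ^+ (3 + k) * p.[(lat a b i)^-1])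
   (\sum_(l < size p) w0 ^+ (3 + k) * p`_l * eis a b (3 + k + l) 0).
Proof.
move=> ab.
have := hassum_sum (index_enum 'I_(size p)) (fun l : 'I_(size p) =>
  hassumZ (w0 ^+ (3 + k) * p`_l) (eisP ab 0 (leq_addr (k + l) 3))).
rewrite (eq_bigr (fun l : 'I_(size p) => w0 ^+ (3 + k) * p`_l * eis a b (3 + k + l) 0));
  last by move=> l _; rewrite addnA.
apply: eq_hassum => i; rewrite horner_coef mulr_sumr; apply: eq_bigr => l _.
by rewrite add0r addnA (exprD _ (3 + k) l) exprMn !exprVn invfM; ring.
Qed.

Section Determined.
Variables a b a' b' : C.
Hypothesis ab : b / a \isn't Num.real.
Hypothesis ab' : b' / a' \isn't Num.real.

(* If w0 were missing from the second lattice, weight the moments with (w0/w)^k P(1/w),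
   where P vanishes at 1/w for the other points |w| < 2|w0| of both lattices: for large k
   the moment of the first lattice tends to P(1/w0) and that of the second to 0. *)
Lemma lat_moments_sub : (forall k, (2 < k)%N -> eis a b k 0 = eis a' b' k 0) ->
  forall i, exists j, lat a b i = lat a' b' j.
Proof.
move=> eG i0; apply: contrapT => nex.
have nj j : lat a' b' j != lat a b i0.
  by apply/eqP => e; apply: nex; exists j.
set w0 := lat a b i0 in nj.
have w00 : w0 != 0.
  by have := nj 0; rewrite lat0 eq_sym.
have r0 : 0 < cnorm w0 by rewrite cnorm_gt0.
have [s0 hs0] := lat_off_disc ab 0 (2 * cnorm w0).
have [s1 hs1] := lat_off_disc ab' 0 (2 * cnorm w0).
have {}hs0 i : i \notin s0 -> 2 * cnorm w0 <= cnorm (lat a b i) by move=> /hs0; rewrite add0r.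
have {}hs1 i : i \notin s1 -> 2 * cnorm w0 <= cnorm (lat a' b' i) by move=> /hs1; rewrite add0r.
have i0s : i0 \in s0 by apply: contraT => /hs0; rewrite -/w0; lra.
pose ws := [seq w <- map (lat a b) s0 ++ map (lat a' b') s1 | w != w0].
pose p : {poly C} := \prod_(x <- map GRing.inv ws) ('X - x%:P).
have rp w : (p.[w^-1] == 0) = (w \in ws).
  by rewrite -[LHS]/(root p w^-1) root_prod_XsubC mem_map //; exact: invr_inj.
have c0 : p.[w0^-1] != 0 by rewrite rp mem_filter eqxx.
set c := p.[w0^-1] in c0.
have [B B0 hB] := lat_tail_moments p ab w00 hs0.
have [B' B0' hB'] := lat_tail_moments p ab' w00 hs1.
have main k : cnorm c <= (B + B') / 2 ^+ k.
  have h1 := lat_moments w0 p k ab; have h2 := lat_moments w0 p k ab'.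
  have eS : \sum_(l < size p) w0 ^+ (3 + k) * p`_l * eis a' b' (3 + k + l) 0 =
            \sum_(l < size p) w0 ^+ (3 + k) * p`_l * eis a b (3 + k + l) 0.
    by apply: eq_bigr => l _; rewrite eG // -addnA.
  rewrite eS in h2; set S := \sum_(l < _) _ in h1 h2 {eS}.
  (* Among the indices of [s0], only i0 has a nonzero term, equal to c; removing it leaves the tail
     of the first lattice, with sum S - c. *)
  have {h1}/hB h1 : hassum (fun i => if i \in s0 then 0 else
       (w0 / lat a b i) ^+ (3 + k) * p.[(lat a b i)^-1]) (S - c).
    apply: eq_hassum (hassumB h1 (hassum_single i0 c)) => i.
    have [->|ii0] := eqVneq i i0.
      by rewrite i0s -/w0 divff // expr1n mul1r subrr.
    rewrite subr0; case: ifP => // is0.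
    suff /eqP -> : p.[(lat a b i)^-1] == 0 by rewrite mulr0.
    rewrite rp mem_filter mem_cat map_f // andbT.
    by apply: contra ii0 => /eqP/(lat_inj ab) ->.
  have {h2}/hB' h2 : hassum (fun i => if i \in s1 then 0 else
       (w0 / lat a' b' i) ^+ (3 + k) * p.[(lat a' b' i)^-1]) S.
    apply: eq_hassum h2 => i; case: ifP => // is1.
    suff /eqP -> : p.[(lat a' b' i)^-1] == 0 by rewrite mulr0.
    by rewrite rp mem_filter mem_cat map_f ?orbT ?nj.
  have := cnormB S (S - c); rewrite opprB addrC subrK; lra.
have pc : 0 < cnorm c by rewrite cnorm_gt0.
have [k hk] : exists k : nat, (B + B') / cnorm c < k%:R.
  exists (Num.bound ((B + B') / cnorm c)).
  by apply: le_lt_trans (archi_boundP _); rewrite ?divr_ge0 ?addr_ge0 ?(ltW pc).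
have h2k : (k%:R : R) <= 2 ^+ k by rewrite -natrX ler_nat ltnW // ltn_expl.
have := main k; rewrite ler_pdivlMr ?exprn_gt0 // => h3.
rewrite ltr_pdivrMr // in hk.
have h4 : cnorm c * k%:R <= cnorm c * 2 ^+ k by rewrite ler_pM2l.
by move: hk; rewrite mulrC ltNge (le_trans h4 h3).
Qed.

End Determined.
End Moments.

(** * Scaling, sublattices of index 3, conjugation *)

Section Scaling.
Variable R : realType.
Local Notation C := R[i].
Local Notation I := (int * int)%type.
Variables a b c : C.
Hypothesis ab : b / a \isn't Num.real.
Hypothesis c0 : c != 0.

Lemma lat_scale i : lat (c * a) (c * b) i = c * lat a b i.
Proof. by rewrite /lat mulrDr !mulrzAr. Qed.

Lemma eis_scale k z : (2 < k)%N ->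
  eis (c * a) (c * b) k (c * z) = c ^- k * eis a b k z.
Proof.
move=> k3; apply: hassum_tsum; apply: eq_hassum (hassumZ (c ^- k) (eisP ab z k3)) => i.
by rewrite lat_scale -mulrDr exprMn invfM.
Qed.

Lemma wp_scale z : wp (c * a) (c * b) (c * z) = c ^- 2 * wp a b z.
Proof.
apply: hassum_tsum; apply: eq_hassum (hassumZ (c ^- 2) (wpP ab z)) => i.
by rewrite lat_scale -mulrDr !exprMn !invfM mulrBr.
Qed.

Lemma ratio_scale : (c * b) / (c * a) = b / a.
Proof. by rewrite invfM mulrACA divff // mul1r. Qed.

End Scaling.

Section Cosets.
Variable R : realType.
Local Notation C := R[i].
Local Notation I := (int * int)%type.
Variables a b : C.
Hypothesis ab : b / a \isn't Num.real.

Lemma ratio_third : (b / 3) / a \isn't Num.real.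
Proof.
apply: contra ab => h.
have -> : b / a = 3 * (b / 3 / a) by field; rewrite (lat_neq0 ab).
by rewrite realM // realn.
Qed.

Lemma lat_third (i : I) (r : int) :
  lat a (b / 3) (i.1, i.2 * 3 + r) = r%:~R * (b / 3) + lat a b i.
Proof.
have n3 : (3 : C) != 0 by rewrite pnatr_eq0.
rewrite /lat /= -(mulrzr a) -(mulrzr (b / 3)) -(mulrzr b) intrD intrM.
have -> : (3%:~R : C) = 3 by [].
by field.
Qed.

(** The overlattice is split by its second index modulo 3; the class of 2 b/3 is that of -b/3 by
    periodicity. *)
Lemma eis_third k z : (2 < k)%N ->
  eis a (b / 3) k z = eis a b k z + eis a b k (z + b / 3) + eis a b k (z - b / 3).
Proof.
move=> k3; apply: hassum_tsum.
pose f i := (z + lat a (b / 3) i) ^- k.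
pose fr (r : int) i := if (i.2 %% 3)%Z == r then f i else 0.
have hr (r : int) : 0 <= r < 3 -> hassum (fr r) (eis a b k (z + r%:~R * (b / 3))).
  move=> hr; pose phi (i : I) : I := (i.1, i.2 * 3 + r).
  pose psi (i : I) : option I :=
    if (i.2 %% 3)%Z == r then Some (i.1, (i.2 %/ 3)%Z) else None.
  have em n : ((n * 3 + r) %% 3)%Z = r by lia.
  have ed n : ((n * 3 + r) %/ 3)%Z = n by lia.
  apply: (hassum_pinj (phi := phi) (psi := psi)).
  - by case=> m n; rewrite /psi /phi /= em eqxx ed.
  - move=> [m n] j; rewrite /psi /phi; case: eqP => //= e [<-] /=.
    by rewrite -[in X in (_, _ + X)]e -divz_eq.
  - by move=> j; rewrite /psi /fr; case: eqP.
  - apply: eq_hassum (eisP ab (z + r%:~R * (b / 3)) k3) => i.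
    by rewrite /fr /phi /= em eqxx /f lat_third -(addrA z).
have := hassumD (hassumD (hr 0 isT) (hr 1 isT)) (hr 2 isT).
have n3 : (3 : C) != 0 by rewrite pnatr_eq0.
have -> : eis a b k (z + 2%:~R * (b / 3)) = eis a b k (z - b / 3).
  rewrite -(eis_period ab (z - b / 3) (0, 1) k3); congr (eis _ _ _ _).
  rewrite /lat /= mulr0z mulr1z add0r.
  have -> : (2%:~R : C) = 2 by [].
  by field.
rewrite mul0r addr0 mul1r; apply: eq_hassum => i; rewrite /fr.
have : (i.2 %% 3)%Z = 0 \/ (i.2 %% 3)%Z = 1 \/ (i.2 %% 3)%Z = 2 by lia.
by case=> [->|[->|->]] /=; rewrite ?addr0 ?add0r.
Qed.

End Cosets.

Section Conjugation.
Variable R : realType.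
Local Notation C := R[i].
Local Notation I := (int * int)%type.

Lemma cnormJ (z : C) : cnorm z^*%C = cnorm z.
Proof. by apply: complexI; rewrite !cnormE normcJ. Qed.

Lemma hassum_conj (J : eqType) (f : J -> C) S :
  hassum f S -> hassum (fun i => (f i)^*%C) (S^*%C).
Proof.
move=> hS e e0; have [s0 h0] := hS e e0; exists s0 => s us sub.
by rewrite -rmorph_sum -rmorphB /= cnormJ h0.
Qed.

Variables a b : C.
Hypothesis ab : b / a \isn't Num.real.
Hypothesis aJ : a^*%C = a.
Hypothesis bJ : b^*%C = - b.

Let opp2 (i : I) : I := (i.1, - i.2).

Let opp2K : cancel opp2 opp2.
Proof. by case=> m n; rewrite /opp2 opprK. Qed.

Let latJ i : (lat a b i)^*%C = lat a b (opp2 i).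
Proof. by rewrite /lat rmorphD /= !rmorphMz /= aJ bJ mulrNz mulNrz. Qed.

Lemma eisJ k z : (2 < k)%N -> (eis a b k z)^*%C = eis a b k z^*%C.
Proof.
move=> k3; apply/esym/hassum_tsum.
apply: eq_hassum (hassum_bij opp2K opp2K (hassum_conj (eisP ab z k3))) => i /=.
by rewrite fmorphV rmorphXn rmorphD /= latJ opp2K.
Qed.

Lemma wpJ z : (wp a b z)^*%C = wp a b z^*%C.
Proof.
apply/esym/hassum_tsum.
apply: eq_hassum (hassum_bij opp2K opp2K (hassum_conj (wpP ab z))) => i /=.
by rewrite rmorphB /= !fmorphV !rmorphXn rmorphD /= latJ opp2K.
Qed.

End Conjugation.

(** * From sums over indices to the functions of the statement *)

Section Bridge.
Local Open Scope classical_set_scope.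
Local Open Scope ring_scope.
Variable R : realType.
Local Notation C := R[i].
Local Notation I := (int * int)%type.

Lemma hassum_lim (f : C -> C) S : hassum f S -> summability.sum (f : C -> C^o) = S.
Proof.
move=> hS; rewrite /summability.sum; have FF := @summability.totally_filter C.
apply: cvg_lim => //; apply/cvgrPdist_lt => e e0.
have [er ee] : exists er : R, e = er%:C.
  by exists (complex.Re e); rewrite RRe_real // gtr0_real.
have [s0 h0] := hS er ltac:(by rewrite ee ltcR in e0).
exists [fset x in s0]%fset => // B sB; rewrite /summability.partial_sum /=.
rewrite ee distrC -cnormE ltcR.
have -> : \sum_(i : B) f (val i) = \sum_(i <- enum_fset B) f i by rewrite big_seq_fsetE.
apply: h0; first exact: fset_uniq.
by move=> x xs; apply: (fsubsetP sB); rewrite inE.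
Qed.

Variables a b : C.
Hypothesis ab : b / a \isn't Num.real.

Lemma mem_lattice z : reflect (exists i, z = lat a b i) (z \in lattice a b).
Proof.
apply: (iffP idP); rewrite inE; first by move=> [m [n ->]]; exists (m, n).
by move=> [[m n] ->]; exists m, n.
Qed.

Lemma lattice_sumE (f : C -> C) S :
  hassum (fun i => if i == 0 then 0 else f (lat a b i)) S ->
  lattice_sum (lattice a b) f = S.
Proof.
move=> hS; apply: hassum_lim.
pose psi (w : C) : option I :=
  if pselect (exists i, lat a b i = w) is left h then Some (projT1 (cid h)) else None.
apply: (hassum_pinj (phi := lat a b) (psi := psi)).
- move=> i; rewrite /psi; case: pselect => [h|[]]; last by exists i.
  by case: (cid h) => j /= /(lat_inj ab) ->.
- by move=> w i; rewrite /psi; case: pselect => // h [<-]; case: (cid h).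
- move=> w; rewrite /psi; case: pselect => // nh _.
  rewrite ifF //; apply/negP; rewrite inE => -[[m [n e]] _].
  by apply: nh; exists (m, n).
- apply: eq_hassum hS => i /=; case: eqVneq => [->|i0].
    rewrite lat0 ifF //; apply/negP; rewrite inE => -[_]; exact.
  rewrite ifT // inE; split; first by case: (i) => m n; exists m, n.
  move=> /= e; case/eqP: i0; apply: (lat_inj ab); by rewrite lat0.
Qed.

Lemma lattice_power_sum k : (2 < k)%N ->
  lattice_sum (lattice a b) (fun w => w ^- k) = eis a b k 0.
Proof.
move=> k3; apply: lattice_sumE; apply: eq_hassum (eisP ab 0 k3) => i.
rewrite add0r; case: eqVneq => // ->.
by rewrite lat0 expr0n gtn_eqF ?invr0 // (ltn_trans _ k3).
Qed.

Lemma lattice_g2E : lattice_g2 (lattice a b) = 60 * eis a b 4 0.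
Proof. by rewrite /lattice_g2 lattice_power_sum. Qed.

Lemma lattice_g3E : lattice_g3 (lattice a b) = 140 * eis a b 6 0.
Proof. by rewrite /lattice_g3 lattice_power_sum. Qed.

(** The definition sums (z - w)^-2 over nonzero w and adds z^-2 apart; [wp] sums (z + w)^-2 over all
    w. Replacing i by -i and splitting off i = 0 reconciles them. *)
Lemma weierstrass_pE z : weierstrass_p (lattice a b) z =
  if z \in lattice a b then None else Some (wp a b z).
Proof.
rewrite /weierstrass_p; case: ifP => // _; congr Some.
have h := hassum_bij (@opprK I) (@opprK I) (wpP ab z).
have := hassumB h (hassum_single 0 (z ^- 2)).
rewrite -[RHS](addrNK (z ^- 2)) [RHS]addrC => hS; congr (_ + _).
apply: lattice_sumE; apply: eq_hassum hS => i /=.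
case: eqVneq => [->|i0]; first by rewrite oppr0 lat0 addr0 expr0n invr0 subr0 subrr.
by rewrite subr0 latN sqrrN.
Qed.

Lemma is_lattice_lattice : is_lattice (lattice a b).
Proof. by exists a, b. Qed.

(** A period maps the pole 0 to a pole, and the poles are the lattice points. *)
Lemma is_period_weierstrass_p w :
  is_period (weierstrass_p (lattice a b)) w <-> w \in lattice a b.
Proof.
have l0 : (0 : C) \in lattice a b by apply/mem_lattice; exists 0; rewrite lat0.
split=> [/(_ 0)|/mem_lattice[j ->] z].
  by rewrite add0r !weierstrass_pE l0; case: ifP.
have e : (z + lat a b j \in lattice a b) = (z \in lattice a b).
  apply/mem_lattice/mem_lattice => -[i e].
    by exists (i - j); rewrite latD latN -e addrK.
  by exists (i + j); rewrite latD -e.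
by rewrite !weierstrass_pE e wp_period.
Qed.

End Bridge.

Lemma lattice_invariants_inj (R : realType) (L M : set R[i]) :
  is_lattice L -> is_lattice M ->
  lattice_g2 L = lattice_g2 M -> lattice_g3 L = lattice_g3 M -> L = M.
Proof.
move=> [a [b [ab ->]]] [a' [b' [ab' ->]]].
rewrite !lattice_g2E // !lattice_g3E // => e2 e3.
have n60 : (60 : R[i]) != 0 by rewrite pnatr_eq0.
have n140 : (140 : R[i]) != 0 by rewrite pnatr_eq0.
have eG := eis0_determined ab ab' (mulfI n60 e2) (mulfI n140 e3).
apply/seteqP; split=> w [m [n ->]].
  by have [[m' n'] e] := lat_moments_sub ab ab' eG (m, n); exists m', n'.
have eG' k : (2 < k)%N -> eis a' b' k 0 = eis a b k 0 by move=> k3; rewrite eG.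
by have [[m' n'] e] := lat_moments_sub ab' ab eG' (m, n); exists m', n'.
Qed.

(** * The 3-division point *)

(* With h = g2/4, the 3-division polynomial factors as
   (x + 1/3) (x (x + 1/3)^2 - (x + h)^2). *)
Lemma real_division_root (R : realType) (s x u : R) : 0 < s -> s < 1 -> u <= 0 ->
  let g2 := 4 / 27 * (9 - 8 * s) in
  let g3 := 8 / 729 * (27 - 36 * s + 8 * s ^+ 2) in
  u = x * (x * x) - g2 / 4 * x - g3 / 4 ->
  3 * ((x * x - g2 / 12) * (x * x - g2 / 12)) = 4 * (x * u) -> x = - (1 / 3).
Proof.
move=> s0 s1 u0 g2 g3 hu h.
set k := (9 - 8 * s) / 27.
have g2E : g2 = 4 * k by rewrite /g2 /k; field.
have g3E : g3 = k ^+ 2 + 2 / 3 * k - 1 / 27 by rewrite /g3 /k; field.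
have k0 : 0 < k by rewrite /k; lra.
have k1 : 1 / 27 < k by rewrite /k; lra.
move: hu h; rewrite {}g2E {}g3E; clearbody k => {g2 g3 s0 s1} hu h.
have fact : (x + 1 / 3) * (x * (x + 1 / 3) ^+ 2 - (x + k) ^+ 2) = 0.
  have -> : (x + 1 / 3) * (x * (x + 1 / 3) ^+ 2 - (x + k) ^+ 2) =
    (4 * (x * (x * (x * x) - 4 * k / 4 * x - (k ^+ 2 + 2 / 3 * k - 1 / 27) / 4))
     - 3 * ((x * x - 4 * k / 12) * (x * x - 4 * k / 12))) by field.
  by rewrite -hu -h subrr.
move/eqP: fact; rewrite mulf_eq0 => /orP[/eqP e|/eqP e]; first lra.
have e' : (x + k) ^+ 2 = x * (x + 1 / 3) ^+ 2 by lra.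
have q0 : 0 <= (x + 1 / 3) ^+ 2 := sqr_ge0 _.
have q1 : 0 <= (x + k) ^+ 2 := sqr_ge0 _.
(* If x < 0, the equation [e'] has a nonpositive right side, which forces x = -1/3. If x > 0, then x
   u <= 0 makes both sides of the division equation 0, so k = 3 x^2, then x = 1/9 and k = 1/27,
   against [k1]. If x = 0, then k = 0. *)
have q2 : 0 <= (x * x - 4 * k / 12) * (x * x - 4 * k / 12) by rewrite -expr2 sqr_ge0.
have [x0|x0|x0] := ltgtP x 0.
- have : (x + 1 / 3) ^+ 2 = 0 by nra.
  by move=> /eqP; rewrite sqrf_eq0 => /eqP; lra.
- have xu : x * u <= 0 by rewrite mulr_ge0_le0 // ltW.
  have /eqP : (x * x - 4 * k / 12) * (x * x - 4 * k / 12) = 0 by lra.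
  rewrite mulf_eq0 orbb => /eqP kx.
  have kE : k = 3 * (x * x) by lra.
  have : (9 * x * (x + 1 / 3) ^+ 2) * (x - 1 / 9) = 0.
    have -> : (9 * x * (x + 1 / 3) ^+ 2) * (x - 1 / 9) =
       (x + 3 * (x * x)) ^+ 2 - x * (x + 1 / 3) ^+ 2 by field.
    by rewrite -kE e' subrr.
  have p0 : 0 < 9 * x * (x + 1 / 3) ^+ 2 by rewrite !mulr_gt0 ?exprn_gt0 //; lra.
  move/eqP; rewrite mulf_eq0 gt_eqF //= subr_eq0 => /eqP xE.
  by move: k1; rewrite kE xE; lra.
- by move: e'; rewrite x0 add0r mul0r => /eqP; rewrite sqrf_eq0 => /eqP; lra.
Qed.

Section Core.
Variable R : realType.
Local Notation C := R[i].

Lemma RtoCD (x y : R) : (x + y)%:C = x%:C + y%:C.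
Proof. exact: rmorphD. Qed.

Lemma RtoCB (x y : R) : (x - y)%:C = x%:C - y%:C.
Proof. exact: rmorphB. Qed.

Lemma RtoCM (x y : R) : (x * y)%:C = x%:C * y%:C.
Proof. exact: rmorphM. Qed.

Lemma RtoCX (x : R) n : (x ^+ n)%:C = x%:C ^+ n.
Proof. exact: rmorphXn. Qed.

Lemma RtoCV (x : R) : (x^-1)%:C = x%:C^-1.
Proof. exact: fmorphV. Qed.

Lemma RtoCn n : (n%:R : R)%:C = n%:R.
Proof. exact: rmorph_nat. Qed.

Lemma RtoC1 : (1 : R)%:C = 1.
Proof. by []. Qed.

Definition RtoCE := (RtoCn, RtoC1, RtoCV, RtoCX, RtoCM, RtoCB, RtoCD).

Lemma conj_fixed (z : C) : z^*%C = z -> z = (complex.Re z)%:C.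
Proof.
by case: z => x y /= [] e; congr (_ +i* _); lra.
Qed.

Lemma conj_opp (z : C) : z^*%C = - z -> z * z = (- complex.Im z ^+ 2)%:C.
Proof.
case: z => x y /= [] e; have -> : x = 0 by lra.
by simpc; rewrite expr2.
Qed.

Variables a b : C.
Hypothesis ab : b / a \isn't Num.real.
Hypothesis aJ : a^*%C = a.
Hypothesis bJ : b^*%C = - b.
Local Notation G k := (eis a b k 0).
Let t := b / 3.

(** A zero would be a relation m a + (n + s/3) b = 0; as 0 < s/3 <= 1/3, the coefficient of b is
    nonzero, so b/a would be real. *)
Lemma third_off_lattice (s : R) : 0 < s -> s <= 1 ->
  forall i, s%:C * t + lat a b i != 0.
Proof.
move=> s0 s1 [m n]; have a0 := lat_neq0 ab.
have r0 : n%:~R + s / 3 != 0.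
  have [n0|n0] := lerP 0 n.
    have : (0 : R) <= n%:~R by rewrite ler0z.
    by move=> ?; apply: lt0r_neq0; lra.
  have : (n%:~R : R) <= -1 by rewrite -[-1]/((-1)%:~R) ler_int; lia.
  by move=> ?; apply: ltr0_neq0; lra.
have rc : ((n%:~R + s / 3)%:C : C) != 0 by rewrite eq_complex /= negb_and r0.
apply: contra ab => /eqP e.
have -> : b / a = - m%:~R / (n%:~R + s / 3)%:C.
  apply: (mulIf a0); apply: (mulIf rc); rewrite divfK // mulrAC divfK //.
  apply/eqP; rewrite -subr_eq0 -[X in _ == X]e /t /lat /= -(mulrzr a) -(mulrzr b).
  rewrite rmorphD rmorphM /= rmorph_int fmorphV rmorph_nat; apply/eqP.
  by field.
by rewrite realM ?realN ?realV ?realz //; apply/complex_realP; exists (n%:~R + s / 3).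
Qed.

Let tL i : t + lat a b i != 0.
Proof. by have := third_off_lattice ltr01 (lexx 1) i; rewrite mul1r. Qed.

Let tJ : t^*%C = - t.
Proof. rewrite /t -mulNr -bJ; have := rmorphM (@conjc R) b 3^-1.
by rewrite fmorphV rmorph_nat. Qed.

Lemma eis_third0 k : (2 < k)%N -> ~~ odd k ->
  eis a (b / 3) k 0 = G k + 2 * eis a b k t.
Proof.
move=> k3 ok; rewrite eis_third // add0r sub0r eisN // -signr_odd (negPf ok) expr0.
by rewrite mul1r -addrA mulr_natl mulr2n.
Qed.

(** With P(t) = -1/3, [eis4E] gives G_4' = G_4 + 2 (1/9 - 5 G_4), and G_6' follows from [eis6E] and
    [eis3E] in the same way. *)
Lemma third_invariants (s : R) : 0 < s -> s < 1 ->
  60 * G 4 = (4 / 27 * (9 - 8 * s))%:C ->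
  140 * G 6 = (8 / 729 * (27 - 36 * s + 8 * s ^+ 2))%:C ->
  60 * eis a (b / 3) 4 0 = 9 * (4 / 27 * (9 - 8 * (1 - s)))%:C /\
  140 * eis a (b / 3) 6 0 = - 27 * (8 / 729 * (27 - 36 * (1 - s) + 8 * (1 - s) ^+ 2))%:C.
Proof.
move=> s0 s1 hG4 hG6.
have e3 := eis3E ab third_off_lattice; have e4 := eis4E ab third_off_lattice.
have e5 := eis5E ab tL; have e6 := eis6E ab tL; have e8 := eis8E ab tL.
have g8 := G8E ab; have := G8E (ratio_third ab).
rewrite !eis_third0 // => g8'.
have xJ : (wp a b t)^*%C = wp a b t by rewrite wpJ // tJ wpN.
have uJ : (eis a b 3 t)^*%C = - eis a b 3 t.
  by rewrite eisJ // tJ eisN // -signr_odd expr1 mulN1r.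
move: g8'.
move: (eis a b 3 t) (eis a b 4 t) (eis a b 5 t) (eis a b 6 t) (eis a b 8 t)
  (wp a b t) e3 e4 e5 e6 e8 xJ uJ => E3 E4 E5 E6 E8 x e3 e4 e5 e6 e8 xJ uJ.
move: (G 4) (G 6) (G 8) g8 hG4 hG6 e3 e4 => G4 G6 G8 g8 hG4 hG6 e3 e4 g8'.
have n10 : (10 : C) != 0 by rewrite pnatr_eq0.
(* Subtract 7 G_8 = 3 G_4^2 from its analogue for the overlattice and eliminate E_8, E_6, E_5 and
   G_4. The outcome is P''^2 = 12 P P'^2, the 3-division equation. *)
have torsion : 3 * (E4 * E4) = 4 * (x * (E3 * E3)).
  have h1 : 2 * (9 * (E4 * E4) + 16 * (E3 * (x * E3)) + 2 * x * (2 * (E3 * E3) + 3 * (x * E4)))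
      = 5 * (3 * (G4 + 2 * E4) ^+ 2) - 5 * (3 * G4 ^+ 2).
    rewrite -g8' -g8 -e6 -e5.
    have -> : 2 * x * (5 * E6) = 10 * (x * E6) by ring.
    by rewrite -e8; ring.
  apply: (mulfI n10).
  have -> : 10 * (3 * (E4 * E4)) = 10 * (4 * (x * (E3 * E3)))
    - (2 * (9 * (E4 * E4) + 16 * (E3 * (x * E3)) + 2 * x * (2 * (E3 * E3) + 3 * (x * E4)))
       - (5 * (3 * (G4 + 2 * E4) ^+ 2) - 5 * (3 * G4 ^+ 2)))
    + 12 * E4 * (x * x - 5 * G4 - E4) by ring.
  by rewrite h1 -e4 !subrr; ring.
(* Conjugation maps t to -t; P is even and E_3 is odd, so P(t) is real and E_3(t) purely
   imaginary. *)
have [xr xE] : exists xr : R, x = xr%:C by exists (complex.Re x); exact: conj_fixed.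
have [ur u0 uE] : exists2 ur : R, ur <= 0 & E3 * E3 = ur%:C.
  exists (- complex.Im E3 ^+ 2); last exact: conj_opp.
  by rewrite oppr_le0 sqr_ge0.
have xrE : xr = - (1 / 3).
  apply: (real_division_root s0 s1 u0).
    apply: complexI; rewrite -uE e3 xE.
    have -> : 15 * G4 = 60 * G4 / 4 by field.
    have -> : 35 * G6 = 140 * G6 / 4 by field.
    rewrite hG4 hG6; move: (4 / 27 * _) (8 / 729 * _) => g2 g3.
    by rewrite !RtoCE.
  apply: complexI; move: torsion; rewrite uE xE e4 xE.
  have -> : 5 * G4 = 60 * G4 / 12 by field.
  rewrite hG4; move: (4 / 27 * _) => g2.
  by rewrite !RtoCE.
have {xE xrE} xE : x = - (1 / 3).
  by rewrite xE xrE rmorphN rmorphM fmorphV rmorph1 rmorph_nat.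
set r := s%:C.
have {}hG4 : 60 * G4 = 4 / 27 * (9 - 8 * r).
  by rewrite hG4 /r !RtoCE.
have {}hG6 : 140 * G6 = 8 / 729 * (27 - 36 * r + 8 * r ^+ 2).
  by rewrite hG6 /r !RtoCE.
have G4E : G4 = 4 / 27 * (9 - 8 * r) / 60 by rewrite -hG4; field.
have G6E : G6 = 8 / 729 * (27 - 36 * r + 8 * r ^+ 2) / 140 by rewrite -hG6; field.
have E6E : E6 = (2 * (E3 * E3) + 3 * (x * E4)) / 5 by rewrite -e6; field.
split.
  have -> : (4 / 27 * (9 - 8 * (1 - s)))%:C = 4 / 27 * (9 - 8 * (1 - r)).
    by rewrite /r !RtoCE.
  by rewrite e4 xE G4E; field.
have -> : (8 / 729 * (27 - 36 * (1 - s) + 8 * (1 - s) ^+ 2))%:C =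
    8 / 729 * (27 - 36 * (1 - r) + 8 * (1 - r) ^+ 2).
  by rewrite /r !RtoCE.
by rewrite E6E e3 e4 xE G4E G6E; field.
Qed.

End Core.

(** * The lattice attached to given invariants, and the theorem *)

Lemma lattice_neq_setT (R : realType) (a b : R[i]) :
  b / a \isn't Num.real -> lattice a b <> [set: R[i]]%classic.
Proof.
move=> ab e; have : lattice a b (a / 2) by rewrite e.
move=> [m [n h]].
have : lat a b (1, 0) = lat a b (m * 2, n * 2).
  rewrite /lat /= mulr1z mulr0z addr0 !mulrzA -mulrzDl -h -mulrzr.
  have -> : (2%:~R : R[i]) = 2 by [].
  by field.
by move=> /(lat_inj ab) [] ; lia.
Qed.

(** If no lattice had these invariants, the default [setT] would make every number a period, against
    [lattice_neq_setT]; otherwise the set of periods is the chosen lattice. *)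
Lemma wp_invariants_periods (R : realType) (g2 g3 a b : R[i]) :
  fundamental_pair_of_periods (wp_invariants g2 g3) a b ->
  lattice_g2 (lattice a b) = g2 /\ lattice_g3 (lattice a b) = g3.
Proof.
rewrite /fundamental_pair_of_periods /wp_invariants => -[ab].
case: xgetP => [L _ [[a0 [b0 [ab0 LE]]] e2 e3]|_] per.
  suff <- : L = lattice a b by [].
  rewrite -per LE; apply/seteqP; split=> w /=.
    by move=> h; apply/(is_period_weierstrass_p ab0); rewrite inE.
  by move=> /(is_period_weierstrass_p ab0); rewrite inE.
exfalso; apply: (lattice_neq_setT ab); rewrite -per.
apply/seteqP; split=> // w _ z; rewrite /weierstrass_p.
have inT (u : R[i]) : u \in [set: R[i]]%classic by rewrite inE.
by rewrite !inT.
Qed.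

Lemma wp_invariantsE (R : realType) (a b : R[i]) : b / a \isn't Num.real ->
  wp_invariants (lattice_g2 (lattice a b)) (lattice_g3 (lattice a b)) =
  weierstrass_p (lattice a b).
Proof.
move=> ab; rewrite /wp_invariants; case: xgetP => [M _ [lM e2 e3]|/(_ (lattice a b)) []].
  by congr weierstrass_p; apply: lattice_invariants_inj => //; exact: is_lattice_lattice.
by split=> //; exact: is_lattice_lattice.
Qed.

(** P has degree -2, and multiplication by c matches the poles; [omap] leaves the point at infinity
    fixed. *)
Lemma weierstrass_p_scale (R : realType) (a b c z : R[i]) :
  b / a \isn't Num.real -> c != 0 ->
  weierstrass_p (lattice a b) z =
  omap (fun v => c ^+ 2 * v) (weierstrass_p (lattice (c * a) (c * b)) (c * z)).
Proof.
move=> ab c0; have abc : (c * b) / (c * a) \isn't Num.real by rewrite ratio_scale.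
have e : (c * z \in lattice (c * a) (c * b)) = (z \in lattice a b).
  apply/mem_lattice/mem_lattice => -[i h]; exists i.
    by apply: (mulfI c0); rewrite -lat_scale.
  by rewrite h lat_scale.
rewrite !weierstrass_pE // e; case: ifP => //= _.
by rewrite wp_scale // mulrA divff ?mul1r // expf_neq0.
Qed.

Unset Implicit Arguments.
Set Strict Implicit.

Theorem theorem4 (R : realType) (kappa lambda : R) (omega omega' : R[i])
    (kappa_gt0 : 0 < kappa) (kappa_lt1 : kappa < 1)
    (lambdaE : lambda = Num.sqrt (1 - kappa ^+ 2))
    (omega_gt0 : 0 < omega) (omega'_gt0 : 0 < - 'i * omega')
    (omegaP : fundamental_pair_of_periods (p_ kappa) (2 * omega) (2 * omega')) :
  let q := wp_half_periods omega (omega' / 3) in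
  forall z : R[i],
    q z = omap (fun v : R[i] => - 3 * v) (p_ lambda ((Num.sqrt 3)%:C * 'i * z)).
Proof.
move=> q z; rewrite {}/q /wp_half_periods mulrA.
have ab : (2 * omega') / (2 * omega) \isn't Num.real by case: omegaP.
have [h2 h3] := wp_invariants_periods omegaP.
have conjM (x y : R[i]) : (x * y)^*%C = x^*%C * y^*%C := rmorphM (@conjc R) x y.
(* In the order of [R[i]], positivity includes being real; hence a is real and b purely imaginary
   below. *)
have omegaJ : omega^*%C = omega.
  by apply/eqP; rewrite -[omega]RRe_real ?conjc_real // gtr0_real.
have omega'J : omega'^*%C = - omega'.
  have i0 : ('i : R[i]) != 0 by rewrite neq0Ci.
  have : (- 'i * omega')^*%C = - 'i * omega'.
    by apply/eqP; rewrite -[- 'i * omega']RRe_real ?conjc_real // gtr0_real.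
  rewrite conjM => e; apply: (mulfI i0); rewrite mulrN -mulNr -[RHS]e.
  congr (_ * _); rewrite -complexiE; apply/eqP.
  by rewrite eq_complex /= oppr0 opprK !eqxx.
have n2J : (2 : R[i])^*%C = 2 by rewrite conjc_nat.
have aJ : (2 * omega)^*%C = 2 * omega by rewrite conjM n2J omegaJ.
have bJ : (2 * omega')^*%C = - (2 * omega') by rewrite conjM n2J omega'J mulrN.
move: (2 * omega) (2 * omega') ab h2 h3 aJ bJ => a b ab h2 h3 aJ bJ.
have ab3 := ratio_third ab.
have s0 : 0 < kappa ^+ 2 by rewrite exprn_gt0.
have s1 : kappa ^+ 2 < 1 by rewrite expr_lt1 // ltW.
have l2 : lambda ^+ 2 = 1 - kappa ^+ 2 by rewrite lambdaE sqr_sqrtr //; lra.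
have l4 : lambda ^+ 4 = (1 - kappa ^+ 2) ^+ 2 by rewrite -l2 -exprM.
have [e4 e6] : 60 * eis a (b / 3) 4 0 = 9 * (4 / 27 * (9 - 8 * (1 - kappa ^+ 2)))%:C /\
  140 * eis a (b / 3) 6 0 =
    - 27 * (8 / 729 * (27 - 36 * (1 - kappa ^+ 2) + 8 * (1 - kappa ^+ 2) ^+ 2))%:C.
  apply: third_invariants => //; first by rewrite -lattice_g2E.
  by rewrite -lattice_g3E // h3 -exprM.
set c := (Num.sqrt 3)%:C * 'i.
have c2 : c ^+ 2 = - 3.
  by rewrite exprMn sqrCi -RtoCX sqr_sqrtr // RtoCn mulrN1.
have n3 : (3 : R[i]) != 0 by rewrite pnatr_eq0.
have c0 : c != 0 by rewrite -sqrf_eq0 c2 oppr_eq0.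
have abc : (c * (b / 3)) / (c * a) \isn't Num.real by rewrite ratio_scale.
(* A lattice is determined by its invariants, so the choice inside [p_] is this lattice; c^4 = 9 and
   c^6 = -27 cancel the factors found in [e4] and [e6]. *)
have -> : p_ lambda = weierstrass_p (lattice (c * a) (c * (b / 3))).
  rewrite -wp_invariantsE // lattice_g2E // lattice_g3E // /p_ l2 l4.
  have es k : (2 < k)%N -> eis (c * a) (c * (b / 3)) k 0 = c ^- k * eis a (b / 3) k 0.
    by move=> k3; rewrite -(eis_scale c ab3 0 k3) mulr0.
  have c4 : c ^+ 4 = 9 by rewrite (exprM c 2 2) c2; ring.
  have c6 : c ^+ 6 = - 27 by rewrite (exprM c 2 3) c2; ring.
  have n9 : (9 : R[i]) != 0 by rewrite pnatr_eq0.
  have n27 : (- 27 : R[i]) != 0 by rewrite oppr_eq0 pnatr_eq0.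
  rewrite !es // c4 c6 (mulrCA 60) (mulrCA 140) e4 e6.
  by rewrite !mulrA mulVf // mulVf // !mul1r.
by rewrite (weierstrass_p_scale _ ab3 c0) c2.
Qed.
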